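(* Let $a,b\in\mathbb{N}_0$. The operator $L_P:\mathcal{H}_L\to\mathcal{H}_L$ is compact and self-adjoint. It has eigenvalues $(-1)^d\lambda_d^{(a,b)}$ for $d\in\mathbb{N}_0$, where $\lambda^{(a,b)}_d=\binom{a+d}{d}\big/\binom{a+b+d+1}{d}$. The normalized eigenfunction for $(-1)^d\lambda^{(a,b)}_d$ is $g_d$. The eigenfunctions $g_0,g_1,\ldots$ are an orthonormal Hilbert space basis for $\mathcal{H}_L$, and $L_P(f)=\sum_{d=0}^\infty(-1)^d\lambda_d^{(a,b)}\langle g_d,f\rangle_{\mathcal{H}_L}\,g_d$ for each $f\in\mathcal{H}_L$.
   Context: Let $\pi_x=C(1-x)^ax^{a+b+1}$ for $x\in[0,1]$, where $C=(2a+b+2)\binom{2a+b+1}{a}$, so that $\int_0^1\pi_x\,\mathrm{d}x=1$. Let $\mathcal{H}_L=\{f(x)/\sqrt{\pi_x}: f\in L^2([0,1])\}$ (real-valued functions modulo equality almost everywhere), with inner product $\langle f,g\rangle_{\mathcal{H}_L}=\int_0^1(1-x)^ax^{a+b+1}f(x)g(x)\,\mathrm{d}x$; this is a Hilbert space. The operator $L_P$ is $$(L_Pf)(x)=(a+b+1)\binom{a+b}{a}\int_{1-x}^1\frac{(1-z)^a(x+z-1)^b}{x^{a+b+1}}f(z)\,\mathrm{d}z .$$ The functions $g_0,g_1,g_2,\ldots$ are obtained by Gram–Schmidt orthonormalization applied to $1,x,x^2,\ldots$ regarded as elements of $\mathcal{H}_L$. *)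

(* Defs.v *)
From HB Require Import structures.
From mathcomp Require Import all_boot all_order all_algebra.
From mathcomp Require Import generic_quotient ring_quotient.
From mathcomp Require Import all_classical all_reals all_analysis.
From mathcomp Require Import measurable_realfun.
From mathcomp Require Import ring lra.

Set Implicit Arguments.
Unset Strict Implicit.
Unset Printing Implicit Defensive.

Import Order.TTheory GRing.Theory Num.Theory.
Import numFieldNormedType.Exports.

Local Open Scope classical_set_scope.
Local Open Scope ring_scope.
Local Open Scope quotient_scope.

Section WeightedL2.
Context (R : realType) (a b : nat).
Local Notation mu := (@lebesgue_measure R).
Local Notation I01 := (`[0, 1]%classic : set R).

Definition HLweight (x : R) : R := (1 - x) ^+ a * x ^+ (a + b + 1).

Definition HLpi (x : R) : R :=
  ((2 * a + b + 2) * 'C(2 * a + b + 1, a))%:R * HLweight x.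

Definition L2_01 (h : R -> R) : Prop :=
  measurable_fun setT h /\ mu.-integrable I01 (fun x => (h x ^+ 2)%:E).

(* Representatives are Borel functions on the whole line; only their values on
   [0, 1], up to null sets, matter in the quotient HL below. The null set is
   needed because HLpi vanishes at 0 and 1, where division by 0 returns 0. *)
Definition HLfun : {pred R -> R} :=
  mem [set f : R -> R | measurable_fun setT f /\
    exists2 h, L2_01 h &
      ae_eq mu I01 f (fun x => h x / Num.sqrt (HLpi x))].

Local Notation C := (((2 * a + b + 2) * 'C(2 * a + b + 1, a))%:R : R).

Lemma HLpi_cst_gt0 : 0 < C.
Proof.
rewrite ltr0n muln_gt0 addn_gt0 orbT /= bin_gt0.
by rewrite mul2n -addnn -!addnA leq_addr.
Qed.

Local Lemma mI01 : measurable I01. Proof. exact: measurable_itv. Qed.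


Local Lemma aeF : Filter (nbhs (almost_everywhere mu)).
Proof. exact: ae_filter_ringOfSetsType. Qed.

Local Lemma intE (f : R -> \bar R) : mu.-integrable I01 f -> forall g : R -> \bar R,
  {in I01, f =1 g} -> mu.-integrable I01 g.
Proof. by move=> ? g ?; exact: (@eq_integrable _ _ R mu I01 mI01 f g). Qed.

Lemma HLweight_ge0 x : I01 x -> 0 <= HLweight x.
Proof.
by rewrite /= in_itv/= => /andP[? ?]; rewrite mulr_ge0 ?exprn_ge0// subr_ge0.
Qed.

Lemma HLweight_gt0 x : 0 < x < 1 -> 0 < HLweight x.
Proof. by move=> /andP[? ?]; rewrite mulr_gt0 ?exprn_gt0// subr_gt0. Qed.

Lemma measurable_HLweight (D : set R) : measurable_fun D HLweight.
Proof.
apply: measurable_funTS; apply: measurable_funM; apply: measurable_funX => //.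
exact: measurable_funB.
Qed.

Lemma ae_01 : {ae mu, forall x, I01 x -> 0 < x < 1}.
Proof.
exists [set 0; 1]; split.
- by apply: measurableU; exact: measurable_set1.
- by apply: countable_lebesgue_measure0; apply: finite_set_countable; exact: finite_set2.
- move=> x /= /not_implyP [].
  rewrite in_itv/= => /andP[x0 x1] nx.
  have [->|xN0] := eqVneq x 0; first by left.
  have [->|xN1] := eqVneq x 1; first by right.
  by exfalso; apply: nx; rewrite !lt_neqAle x0 x1 eq_sym xN0 xN1.
Qed.

Lemma measurable_HLweightM (D : set R) (f g : R -> R) :
  measurable_fun setT f -> measurable_fun setT g ->
  measurable_fun D (fun x => (HLweight x * f x * g x)%:E).
Proof.
move=> mf mg; apply/measurable_EFinP; apply: measurable_funTS.
apply: measurable_funM => //; apply: measurable_funM => //.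
exact: measurable_HLweight.
Qed.

Lemma HLfunP (f : R -> R) : f \in HLfun <->
  measurable_fun setT f /\
  mu.-integrable I01 (fun x => (HLweight x * f x * f x)%:E).
Proof.
split => [/set_mem[mf [h [mh ih] fh]]|[mf wf]].
  split => //.
  have mwf := @measurable_HLweightM I01 f f mf mf.
  have ihC : mu.-integrable I01 (fun x => (C^-1 * h x ^+ 2)%:E).
    apply: (intE (@integrableZl _ _ R mu I01 mI01 C^-1 _ ih)) => x _ /=.
    by rewrite -EFinM.
  apply/integrableP; split => //.
  move/integrableP : (ihC) => [mhC]; apply: le_lt_trans.
  rewrite le_eqVlt; apply/orP; left; apply/eqP.
  apply: ge0_ae_eq_integral => //.
  - exact: measurableT_comp.
  - exact: measurableT_comp.
  - have := ae_01; apply: filterS2 fh => x fx x01 Ix.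
    congr (`| _%:E |)%E.
    have w0 := HLweight_gt0 (x01 Ix).
    rewrite fx// -mulrA -expr2 exprMn.
    rewrite exprVn sqr_sqrtr; last by rewrite mulr_ge0// ltW.
    rewrite -[HLpi x]/(C * HLweight x).
    move: (HLweight x) w0 (h x) (C) HLpi_cst_gt0 => w w0 y c c0.
    by field; rewrite !gt_eqF.
apply/mem_set; split => //.
exists (fun x => f x * Num.sqrt (HLpi x)).
  split.
    apply: measurable_funM => //.
    have msqrt : measurable_fun setT (@Num.sqrt R).
      apply: continuous_measurable_fun. exact: sqrt_continuous.
    apply: (measurableT_comp msqrt).
    by apply: measurable_funM => //; exact: measurable_HLweight.
  apply: (intE (@integrableZl _ _ R mu I01 mI01 C _ wf)) => x /set_mem Ix /=.
  rewrite exprMn sqr_sqrtr; last by rewrite mulr_ge0 ?HLweight_ge0 ?(ltW HLpi_cst_gt0).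
  by rewrite -EFinM -[HLpi x]/(C * HLweight x); congr (_%:E); ring.
apply: (@filterS _ _ aeF _ _ _ ae_01) => x x01 Ix.
have w0 := HLweight_gt0 (x01 Ix).
by rewrite mulfK// gt_eqF// sqrtr_gt0 mulr_gt0 ?HLpi_cst_gt0.
Qed.

Lemma HLfun_measurable (f : R -> R) : f \in HLfun -> measurable_fun setT f.
Proof. by move=> /HLfunP[]. Qed.

Lemma HLfun_integrableM (f g : R -> R) : f \in HLfun -> g \in HLfun ->
  mu.-integrable I01 (fun x => (HLweight x * f x * g x)%:E).
Proof.
move=> /HLfunP[mf wf] /HLfunP[mg wg].
apply: (@le_integrable _ _ R mu I01 mI01 _ _ _ _ (@integrableD _ _ R mu I01 mI01 _ _ wf wg)).
  exact: measurable_HLweightM.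
move=> x Ix; have w0 := HLweight_ge0 Ix.
rewrite -EFinD !abse_EFin lee_fin.
move: (HLweight x) w0 (f x) (g x) => w w0 u v.
rewrite -!mulrA -mulrDr !normrM ler_wpM2l//.
rewrite [leRHS]ger0_norm ?addr_ge0 -?expr2 ?sqr_ge0//.
rewrite -(real_normK (num_real u)) -(real_normK (num_real v)).
have := normr_ge0 u; have := normr_ge0 v; nra.
Qed.

Lemma HLfun_submod_closed : submod_closed HLfun.
Proof.
split.
  apply/HLfunP; split; first exact: measurable_cst.
  have i0 : mu.-integrable I01 (cst 0%E) by exact: integrable0.
  by apply: (intE i0) => x _ /=; rewrite mulr0.
move=> k f g ff gg; apply/HLfunP.
have mf := HLfun_measurable ff; have mg := HLfun_measurable gg.
have mkfg : measurable_fun setT (k *: f + g).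
  by apply: measurable_funD => //; apply: measurable_funM.
split => //.
have i1 := @integrableZl _ _ R mu I01 mI01 (k ^+ 2) _ (HLfun_integrableM ff ff).
have i2 := @integrableZl _ _ R mu I01 mI01 (2 * k) _ (HLfun_integrableM ff gg).
have i3 := HLfun_integrableM gg gg.
apply: (intE (@integrableD _ _ R mu I01 mI01 _ _ (@integrableD _ _ R mu I01 mI01 _ _ i1 i2) i3)) => x _ /=.
rewrite -!EFinM -!EFinD; congr (_%:E).
rewrite -[(k *: f + g) x]/(k * f x + g x).
by move: (HLweight x) (f x) (g x) => w u v; ring.
Qed.

HB.instance Definition _ := GRing.isSubmodClosed.Build R (R -> R) HLfun
  HLfun_submod_closed.

Record HLrep := MkHLrep { HLval :> R -> R; HLvalP : HLval \in HLfun }.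

HB.instance Definition _ := [isSub for HLval].
HB.instance Definition _ := [Choice of HLrep by <:].
HB.instance Definition _ := [SubChoice_isSubLmodule of HLrep by <:].

Definition HLnull : {pred HLrep} :=
  mem [set f : HLrep | ae_eq mu I01 f (cst 0)].

Lemma HLnull_zmod_closed : zmod_closed HLnull.
Proof.
split.
  by apply/mem_set; apply: aeW.
move=> f g /set_mem f0 /set_mem g0; apply/mem_set.
apply: (@filterS2 _ _ aeF _ _ _ _ f0 g0) => x fx gx Ix.
by rewrite -[(f - g) x]/(f x - g x) fx// gx// subrr.
Qed.

HB.instance Definition _ := GRing.isZmodClosed.Build HLrep HLnull
  HLnull_zmod_closed.

Definition HL : Type := Quotient.quot (HLnull : zmodClosed HLrep).

HB.instance Definition _ := Choice.on HL.
HB.instance Definition _ := GRing.Zmodule.on HL.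
HB.instance Definition _ := EqQuotient.on HL.

Lemma HL_eqP (f g : HLrep) : \pi_HL f = \pi_HL g <-> ae_eq mu I01 f g.
Proof.
have -> : (\pi_HL f = \pi_HL g) <-> (f - g \in HLnull).
  have := Quotient.idealrBE (HLnull : zmodClosed HLrep) f g.
  by split => [/eqP|fg]; [rewrite H|apply/eqP; rewrite -H].
split => [/set_mem|] fg; last apply/mem_set;
  apply: (@filterS _ _ aeF _ _ _ fg) => x fgx Ix.
  by apply/subr0_eq; exact: (fgx Ix).
by apply: etrans (subrr (g x)); congr (_ - _); exact: (fgx Ix).
Qed.

Lemma HL_piD (f g : HLrep) : \pi_HL (f + g) = \pi_HL f + \pi_HL g.
Proof. exact: (@Quotient.pi_add _ (HLnull : zmodClosed HLrep) f g). Qed.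

Lemma repr_pi (f : HLrep) : ae_eq mu I01 (repr (\pi_HL f)) f.
Proof. by apply/HL_eqP; rewrite reprK. Qed.

Definition HLscale (k : R) (u : HL) : HL := \pi_HL (k *: repr u).

Lemma HL_piZ k (f : HLrep) : \pi_HL (k *: f) = HLscale k (\pi_HL f).
Proof.
apply/HL_eqP; apply: (@filterS _ _ aeF _ _ _ (repr_pi f)) => x + Ix.
move=> /(_ Ix) fx.
by rewrite -[LHS]/(k * f x) -[RHS]/(k * (repr (\pi_HL f) : HLrep) x) fx.
Qed.

Lemma HLscaleA k l u : HLscale k (HLscale l u) = HLscale (k * l) u.
Proof. by rewrite -[u]reprK -(HL_piZ l) -(HL_piZ k) -HL_piZ scalerA. Qed.

Lemma HLscale1 : left_id 1 HLscale.
Proof. by move=> u; rewrite -[u]reprK -!HL_piZ scale1r. Qed.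

Lemma HLscaleDr : right_distributive HLscale +%R.
Proof.
move=> k u v.
rewrite -[u]reprK -[v]reprK -[\pi_HL _ + \pi_HL _ in LHS]HL_piD.
by rewrite -!HL_piZ -HL_piD scalerDr.
Qed.

Lemma HLscaleDl u : {morph HLscale^~ u : k l / k + l}.
Proof.
by move=> k l /=; rewrite -[u]reprK -!HL_piZ -HL_piD scalerDl.
Qed.

HB.instance Definition _ := GRing.Zmodule_isLmodule.Build R HL
  HLscaleA HLscale1 HLscaleDr HLscaleDl.

Definition HLdot (u v : HL) : R :=
  \int[mu]_(x in I01) (HLweight x * repr u x * repr v x).

Definition HLnorm (u : HL) : R := Num.sqrt (HLdot u u).

Lemma HLdot_pi (f g : HLrep) :
  HLdot (\pi_HL f) (\pi_HL g) = \int[mu]_(x in I01) (HLweight x * f x * g x).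
Proof.
have m (h : HLrep) := HLfun_measurable (HLvalP h).
congr fine; apply: ae_eq_integral => //; try exact: measurable_HLweightM.
apply: (@filterS2 _ _ aeF _ _ _ _ (repr_pi f) (repr_pi g)) => x fx gx Ix.
by rewrite fx// gx.
Qed.

Lemma HLdotC u v : HLdot u v = HLdot v u.
Proof. by apply: eq_Rintegral => x _; rewrite mulrAC. Qed.

Lemma HLdotPl k u v w : HLdot (k *: u + v) w = k * HLdot u w + HLdot v w.
Proof.
rewrite -[u]reprK -[v]reprK -[w]reprK.
move: (repr u) (repr v) (repr w) => f g h.
have -> : k *: \pi_HL f + \pi_HL g = \pi_HL (k *: f + g).
  by rewrite HL_piD HL_piZ.
have i (f1 f2 : HLrep) := HLfun_integrableM (HLvalP f1) (HLvalP f2).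
rewrite !HLdot_pi -RintegralZl//; last exact: i.
rewrite -RintegralD//; last 2 first.
- apply: (intE (@integrableZl _ _ R mu I01 mI01 k _ (i f h))) => x _ /=.
  by rewrite -EFinM.
- exact: i.
apply: eq_Rintegral => x _; rewrite -[(k *: f + g) x]/(k * f x + g x).
by move: (HLweight x) (f x) (g x) (h x) => w1 p q r; ring.
Qed.

Lemma HLdot_ge0 u : 0 <= HLdot u u.
Proof.
apply: Rintegral_ge0 => x Ix; rewrite -mulrA -expr2.
by rewrite mulr_ge0 ?sqr_ge0 ?HLweight_ge0.
Qed.

Lemma HLdot_eq0 u : HLdot u u = 0 -> u = 0.
Proof.
rewrite -[u]reprK; move: (repr u) => f; rewrite HLdot_pi => f0.
have i := HLfun_integrableM (HLvalP f) (HLvalP f).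
rewrite -[0](_ : \pi_HL 0 = _); last first.
  by apply: (addrI (\pi_HL 0)); rewrite -HL_piD !addr0.
apply/HL_eqP.
have /ae_eq_integral_abs H : (\int[mu]_(x in I01) `|(HLweight x * f x * f x)%:E| = 0)%E.
  under eq_integral => x /set_mem Ix.
    rewrite gee0_abs; last first.
      by rewrite lee_fin -mulrA -expr2 mulr_ge0 ?sqr_ge0 ?HLweight_ge0.
    over.
  rewrite -(@fineK _ (integral _ _ _)) ?[fine _]f0//.
  exact: integrable_fin_num.
have m := HLfun_measurable (HLvalP f).
apply: (@filterS2 _ _ aeF _ _ _ _ ae_01 (H mI01 _)); last first.
  exact: measurable_HLweightM.
move=> x x01 + Ix => /(_ Ix) /= [] /eqP; rewrite -mulrA mulf_eq0.
by rewrite gt_eqF ?HLweight_gt0 ?x01//= mulf_eq0 orbb => /eqP.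
Qed.

Lemma HLdotZl k u w : HLdot (k *: u) w = k * HLdot u w.
Proof.
have := HLdotPl k u 0 w; rewrite addr0 => ->.
have := HLdotPl 0 0 0 w; rewrite scale0r addr0 mul0r add0r => _.
have := HLdotPl (-1) 0 0 w; rewrite scaler0 addr0 mulN1r addNr => ->.
by rewrite addr0.
Qed.

Lemma HLdotDl u v w : HLdot (u + v) w = HLdot u w + HLdot v w.
Proof. by have := HLdotPl 1 u v w; rewrite scale1r mul1r. Qed.

Lemma HLnormZ k u : HLnorm (k *: u) = `|k| * HLnorm u.
Proof.
rewrite /HLnorm HLdotZl HLdotC HLdotZl mulrA -expr2 sqrtrM ?sqr_ge0//.
by rewrite sqrtr_sqr.
Qed.

Lemma HLnorm_eq0 u : HLnorm u = 0 -> u = 0.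
Proof.
move=> /eqP; rewrite sqrtr_eq0 => u0; apply: HLdot_eq0.
by apply/eqP; rewrite eq_le u0 HLdot_ge0.
Qed.

Lemma HL_cauchy_schwarz u v : HLdot u v <= HLnorm u * HLnorm v.
Proof.
have [->|v0] := eqVneq v 0.
  by rewrite HLdotC -[0](scale0r 0) HLdotZl mul0r mulr_ge0 ?sqrtr_ge0.
have vv : 0 < HLdot v v.
  rewrite lt_def HLdot_ge0 andbT; apply: contra_neq v0; exact: HLdot_eq0.
rewrite -sqrtrM ?HLdot_ge0//.
apply: le_trans (ler_norm _) _; rewrite -sqrtr_sqr; apply: ler_wsqrtr.
have := HLdot_ge0 ((- HLdot u v) *: v + HLdot v v *: u).
rewrite HLdotPl HLdotZl ![HLdot _ (_ + _)]HLdotC !HLdotPl !HLdotZl.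
rewrite (HLdotC v u).
move: (HLdot u u) (HLdot v v) vv (HLdot u v) => p q q0 r H.
have : 0 <= q * (p * q - r ^+ 2) by move: H; congr (_ <= _); ring.
by rewrite pmulr_rge0// subr_ge0.
Qed.

Lemma ler_HLnormD u v : HLnorm (u + v) <= HLnorm u + HLnorm v.
Proof.
rewrite -[leRHS]ger0_norm ?addr_ge0 ?sqrtr_ge0// -sqrtr_sqr; apply: ler_wsqrtr.
rewrite sqrrD !sqr_sqrtr ?HLdot_ge0// HLdotDl ![HLdot _ (u + v)]HLdotC.
rewrite !HLdotDl (HLdotC v u).
have := HL_cauchy_schwarz u v; lra.
Qed.

HB.instance Definition _ := Lmodule_isNormed.Build R HL
  ler_HLnormD HLnormZ HLnorm_eq0.

Lemma HL_monomial_subproof (d : nat) : (fun x : R => x ^+ d) \in HLfun.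
Proof.
apply/HLfunP; split; first exact: measurable_funX.
have i := @beta_distribution.integrable_XMonemX R (a + b + 1 + d + d) a.
apply: (intE i) => x _; congr (_%:E).
rewrite -[LHS]/(x ^+ (a + b + 1 + d + d) * (1 - x) ^+ a) /HLweight !exprD.
by ring.
Qed.

Definition HL_monomial (d : nat) : HL :=
  \pi_HL (MkHLrep (HL_monomial_subproof d)).

Definition LP_integrand (f : R -> R) (x z : R) : R :=
  (1 - z) ^+ a * (x + z - 1) ^+ b / x ^+ (a + b + 1) * f z.

Definition LP_fun (f : R -> R) (x : R) : R :=
  ((a + b + 1) * 'C(a + b, a))%:R *
  \int[mu]_(z in `[1 - x, 1]%classic) LP_integrand f x z.

(* T is the operator L_P on classes: the integral exists for almost every x
   and, for every representative f, gives a representative of T [f] *)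
Definition is_LP (T : HL -> HL) : Prop := forall f : HLrep,
  {ae mu, forall x, I01 x ->
    mu.-integrable `[1 - x, 1]%classic (fun z => (LP_integrand f x z)%:E)} /\
  ae_eq mu I01 (repr (T (\pi_HL f))) (LP_fun f).

Definition lambda (d : nat) : R :=
  'C(a + d, d)%:R / 'C(a + b + d + 1, d)%:R.

End WeightedL2.

Section GramSchmidt.
Context (R : realType) (V : lmodType R) (dot : V -> V -> R) (v : nat -> V).

Fixpoint gram_schmidt_seq (n : nat) : seq V :=
  if n is m.+1 then
    let s := gram_schmidt_seq m in
    let e := v m - \sum_(g <- s) dot g (v m) *: g in
    rcons s ((Num.sqrt (dot e e))^-1 *: e)
  else [::].

Definition gram_schmidt (n : nat) : V := nth 0 (gram_schmidt_seq n.+1) n.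

End GramSchmidt.

Definition HLg (R : realType) (a b : nat) : nat -> HL R a b :=
  gram_schmidt (@HLdot R a b) (@HL_monomial R a b).

Section Operators.
Context (R : realType) (V : normedModType R) (dot : V -> V -> R).

Definition compact_operator (T : V -> V) : Prop :=
  forall A : set V, bounded_set A -> precompact (T @` A).

Definition self_adjoint (T : V -> V) : Prop :=
  forall u v, dot (T u) v = dot u (T v).

Definition op_eigenvalue (T : V -> V) (l : R) : Prop :=
  exists2 u, u != 0 & T u = l *: u.

Definition orthonormal_basis (e : nat -> V) : Prop :=
  (forall i j, dot (e i) (e j) = (i == j)%:R) /\
  closure [set u | exists n (c : nat -> R), u = \sum_(i < n) c i *: e i]
    = [set: V].

End Operators.

(* Main.v *)
Require Import Defs.
From HB Require Import structures.
From mathcomp Require Import all_boot all_order all_algebra.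
From mathcomp Require Import generic_quotient ring_quotient.
From mathcomp Require Import all_classical all_reals all_analysis.
From mathcomp Require Import measurable_realfun.
From mathcomp Require Import ring lra.

(* With w x = (1 - x)^a x^(a+b+1), the weighted operator w L_P has a symmetric
   nonnegative kernel J on the unit square whose marginal is w. By Fubini L_P is
   symmetric, and by Cauchy-Schwarz against J it is a contraction of H_L. The
   incomplete beta integral gives
     L_P x^n = sum_(k <= n) (-1)^k C(n, k) lambda_k x^k,
   so L_P is triangular on the monomials with diagonal (-1)^n lambda_n; being
   symmetric, it is diagonal on their orthonormalization g_0, g_1, ...
   Polynomials are total in H_L, because (1 - x^n)^m with m ~ t^(-n) converges
   boundedly to the indicator of [0, t); with the completeness of H_L
   (Riesz-Fischer) this makes (g_n) a Hilbert basis. Finally lambda_n = O(1/n)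
   is square summable, so that L_P maps balls into continuous images of the
   Hilbert cube, which are compact. *)

Set Implicit Arguments.
Unset Strict Implicit.
Unset Printing Implicit Defensive.

Import Order.TTheory GRing.Theory Num.Theory.
Import numFieldNormedType.Exports.

Local Open Scope classical_set_scope.
Local Open Scope ring_scope.

(** * Orthonormalization and diagonal operators *)

(** The defining integral exists only for almost every x, its domain moves with x and it divides by
    x^(a+b+1). Extending the kernel by 0 to the whole plane gives Fubini a fixed domain, which
    yields measurability in x and existence almost everywhere. Up to normalization the kernel is a
    joint law with both marginals w, and L_P f is the corresponding conditional mean: hence it fixes
    constants, and Jensen's inequality makes it a contraction. The contraction property supplies the
    continuity that carries L_P through orthonormal expansions. Points of the Hilbert cube are
    bounded only coordinate by coordinate, so mu_n -> 0 alone would not make the series of mu_i c_i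
    e_i converge on it; square summability does, and Tychonoff then gives compactness. The
    alternating signs cannot merge two eigenvalues, because their absolute values lambda_n strictly
    decrease; therefore every eigenspace is a line. *)

Section Span.
Context (R : realType) (V : lmodType R).
Implicit Types (w : nat -> V) (n : nat) (u v : V).

Definition spanned w n u := exists c : nat -> R, u = \sum_(i < n) c i *: w i.

Lemma spannedP w n k u v : spanned w n u -> spanned w n v ->
  spanned w n (k *: u + v).
Proof.
move=> [c ->] [d ->]; exists (fun i => k * c i + d i).
rewrite scaler_sumr -big_split; apply: eq_bigr => i _.
by rewrite scalerDl scalerA.
Qed.

Lemma spanned0 w n : spanned w n 0.
Proof.
by exists (fun=> 0); rewrite big1 // => i _; rewrite scale0r.
Qed.

Lemma spannedZ w n k u : spanned w n u -> spanned w n (k *: u).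
Proof. by move=> wu; rewrite -[_ *: _]addr0; apply/spannedP/spanned0. Qed.

Lemma spannedD w n u v : spanned w n u -> spanned w n v -> spanned w n (u + v).
Proof. by rewrite -[u in u + _]scale1r; apply: spannedP. Qed.

Lemma spannedB w n u v : spanned w n u -> spanned w n v -> spanned w n (u - v).
Proof. by move=> wu wv; rewrite addrC -scaleN1r; apply: spannedP. Qed.

Lemma spanned_sum w n m (u : 'I_m -> V) :
  (forall i, spanned w n (u i)) -> spanned w n (\sum_(i < m) u i).
Proof.
move=> wu; elim/big_ind : _ => [|x y|i _]; first exact: spanned0.
- exact: spannedD.
- exact: wu.
Qed.

Lemma spanned_mem w n i : (i < n)%N -> spanned w n (w i).
Proof.
move=> ltin; exists (fun j => (j == i)%:R).
rewrite (bigD1 (Ordinal ltin)) //= eqxx scale1r big1 ?addr0 // => j ji.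
by rewrite -[X in X == _]/(val j) -[i in _ == i]/(val (Ordinal ltin)) val_eqE (negbTE ji) scale0r.
Qed.

Lemma spanned_sub w w' n m u : (forall i, (i < n)%N -> spanned w' m (w i)) ->
  spanned w n u -> spanned w' m u.
Proof.
by move=> ww [c ->]; apply: spanned_sum => i; apply/spannedZ/ww.
Qed.

Lemma spanned_leq w n m u : (n <= m)%N -> spanned w n u -> spanned w m u.
Proof.
by move=> nm; apply: (@spanned_sub w w n m) => i lti; apply/spanned_mem/(leq_trans lti).
Qed.

Lemma spannedS w n u : spanned w n.+1 u ->
  exists k, exists2 v, spanned w n v & u = k *: w n + v.
Proof.
move=> [c ->]; exists (c n); exists (\sum_(i < n) c i *: w i); first by exists c.
by rewrite big_ord_recr addrC.
Qed.

End Span.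

(** * Inner products that induce the norm *)

Section InnerProduct.
Context (R : realType) (V : normedModType R) (dot : V -> V -> R).
Context (dotC : forall u v, dot u v = dot v u)
  (dotPl : forall k u v w, dot (k *: u + v) w = k * dot u w + dot v w)
  (dot_norm : forall u, dot u u = `|u| ^+ 2).
Implicit Types (u v w : V) (n : nat).

Lemma dot0l w : dot 0 w = 0.
Proof.
have := dotPl (-1) 0 0 w; rewrite scaler0 addr0 mulN1r addNr; exact.
Qed.

Lemma dotZl k u w : dot (k *: u) w = k * dot u w.
Proof. by rewrite -[k *: u]addr0 dotPl dot0l addr0. Qed.

Lemma dotDl u v w : dot (u + v) w = dot u w + dot v w.
Proof. by rewrite -[u in u + _]scale1r dotPl mul1r. Qed.

Lemma dotBl u v w : dot (u - v) w = dot u w - dot v w.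
Proof. by rewrite dotDl -scaleN1r dotZl mulN1r. Qed.

Lemma dotZr k u w : dot u (k *: w) = k * dot u w.
Proof. by rewrite dotC dotZl dotC. Qed.

Lemma dotDr u v w : dot w (u + v) = dot w u + dot w v.
Proof. by rewrite !(dotC w) dotDl. Qed.

Lemma dotBr u v w : dot w (u - v) = dot w u - dot w v.
Proof. by rewrite !(dotC w) dotBl. Qed.

Lemma dot_suml n (u : 'I_n -> V) w :
  dot (\sum_(i < n) u i) w = \sum_(i < n) dot (u i) w.
Proof. by apply: (big_morph (dot^~ w)) => [x y|]; rewrite ?dotDl ?dot0l. Qed.

Lemma dot_sumr n (u : 'I_n -> V) w :
  dot w (\sum_(i < n) u i) = \sum_(i < n) dot w (u i).
Proof. by rewrite dotC dot_suml; apply: eq_bigr => i _; rewrite dotC. Qed.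

Lemma dot_eq0 u : dot u u = 0 -> u = 0.
Proof. by move/eqP; rewrite dot_norm sqrf_eq0 normr_eq0 => /eqP. Qed.

(** Cauchy-Schwarz, read off from the square of the triangle inequality that the norm already
    satisfies. *)
Lemma dot_le u v : dot u v <= `|u| * `|v|.
Proof.
have : `|u + v| ^+ 2 <= (`|u| + `|v|) ^+ 2 by rewrite lerXn2r ?nnegrE ?addr_ge0 ?ler_normD.
rewrite -dot_norm dotDl !dotDr !dot_norm (dotC v u).
by nra.
Qed.

Lemma dot_norm_le u v : `|dot u v| <= `|u| * `|v|.
Proof.
rewrite ler_norml dot_le andbT lerNl.
by rewrite -mulN1r -dotZl scaleN1r (le_trans (dot_le _ _)) // normrN.
Qed.

Lemma cvgn_unique_real (r : nat -> R) (x y : R) : r @ \oo --> x -> r @ \oo --> y -> x = y.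
Proof. by move=> /(cvg_lim (@Rhausdorff R)) <- /(cvg_lim (@Rhausdorff R)) <-. Qed.

Lemma dot_cvg (u_ : nat -> V) u w : u_ @ \oo --> u ->
  (dot (u_ n) w) @[n --> \oo] --> dot u w.
Proof.
move=> /cvgrPdist_lt uu; apply/cvgrPdist_lt => e e0.
have w1 : 0 < `|w| + 1 by rewrite ltr_pwDr.
near=> n; rewrite -dotBl (le_lt_trans (dot_norm_le _ _)) //.
rewrite (@le_lt_trans _ _ (`|u - u_ n| * (`|w| + 1))) ?ler_wpM2l ?lerDl //.
by rewrite -ltr_pdivlMr //; near: n; apply: uu; rewrite divr_gt0.
Unshelve. all: by end_near. Qed.

Lemma orthonormal_dot_sum (g : nat -> V) n (c : nat -> R) j :
  (forall i j, dot (g i) (g j) = (i == j)%:R) ->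
  dot (g j) (\sum_(i < n) c i *: g i) = if (j < n)%N then c j else 0.
Proof.
move=> gg; rewrite dot_sumr.
under eq_bigr do rewrite dotZr gg.
case: ifP => [ltjn|/negbT].
  rewrite (bigD1 (Ordinal ltjn)) //= eqxx mulr1 big1 ?addr0 // => i.
  by rewrite -val_eqE /= eq_sym => /negbTE ->; rewrite mulr0.
rewrite -leqNgt => lenj; rewrite big1 // => i _.
by rewrite gtn_eqF ?mulr0 // (leq_trans (ltn_ord i)).
Qed.

(** * Gram-Schmidt orthonormalization of a free family *)

Section GramSchmidt.
Context (v : nat -> V) (v_free : forall n, ~ spanned v n (v n)).
Local Notation g := (gram_schmidt dot v).

Lemma size_gram_schmidt_seq n : size (gram_schmidt_seq dot v n) = n.
Proof. by elim: n => //= n IHn; rewrite size_rcons IHn. Qed.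

(** The recursion only appends to the list, so vectors already produced never change. *)
Lemma gram_schmidt_seqE n : gram_schmidt_seq dot v n = mkseq g n.
Proof.
elim: n => // n IHn; rewrite /mkseq -addn1 iotaD map_cat -[map _ _]/(mkseq g n) -IHn.
rewrite add0n addn1 /= -cats1; congr (_ ++ [:: _]).
by rewrite /gram_schmidt /= nth_rcons size_gram_schmidt_seq ltnn eqxx.
Qed.

Definition gram_schmidt_residue n := v n - \sum_(i < n) dot (g i) (v n) *: g i.

Lemma gram_schmidtE n :
  g n = `|gram_schmidt_residue n|^-1 *: gram_schmidt_residue n.
Proof.
have e : v n - \sum_(x <- gram_schmidt_seq dot v n) dot x (v n) *: x = gram_schmidt_residue n.
  rewrite /gram_schmidt_residue -(big_mkord xpredT (fun i => dot (g i) (v n) *: g i)).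
  by rewrite /index_iota subn0 gram_schmidt_seqE big_map.
rewrite {1}/gram_schmidt /= nth_rcons size_gram_schmidt_seq ltnn eqxx e.
by rewrite dot_norm sqrtr_sqr ger0_norm.
Qed.

(** The three facts need one joint induction: normalizing requires a nonzero residue, and a zero
    residue would put [v n] in the span of the earlier [g i], hence of the earlier [v i], against
    freeness. *)
Lemma gram_schmidt_spec n :
  [/\ forall i j, (i < n)%N -> (j < n)%N -> dot (g i) (g j) = (i == j)%:R,
      forall i, (i < n)%N -> spanned v i.+1 (g i) &
      forall i, (i < n)%N -> spanned g i.+1 (v i)].
Proof.
elim: n => [|n [ogg gv vg]]; first by split.
set r := gram_schmidt_residue n.
have r_v : spanned v n (r - v n).
  rewrite /r /gram_schmidt_residue addrC addKr -sumrN.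
  apply: spanned_sum => i; rewrite -scaleNr; apply: spannedZ.
  exact: (spanned_leq (ltn_ord i) (gv _ (ltn_ord i))).
have r0 : r != 0.
  apply/eqP => r0; apply: (@v_free n); have -> : v n = (-1) *: (r - v n).
    by rewrite r0 sub0r scaleN1r opprK.
  exact: spannedZ.
have nr0 : `|r| != 0 by rewrite normr_eq0.
have ogr i : (i < n)%N -> dot (g i) r = 0.
  move=> lti; rewrite /r /gram_schmidt_residue dotBr dot_sumr (bigD1 (Ordinal lti)) //=.
  rewrite dotZr ogg // eqxx mulr1 big1 ?addr0 ?subrr // => j.
  by rewrite -val_eqE /= eq_sym => /negbTE jn; rewrite dotZr ogg // jn mulr0.
have ogn i : (i < n)%N -> dot (g i) (g n) = 0.
  by move=> lti; rewrite [g n]gram_schmidtE dotZr ogr // mulr0.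
have ognn : dot (g n) (g n) = 1.
  by rewrite gram_schmidtE dotZl dotZr dot_norm -/r expr2 mulKf // mulVf.
split => [i j|i|i]; rewrite !ltnS.
- rewrite leq_eqVlt => /predU1P[->|lti]; rewrite leq_eqVlt => /predU1P[->|ltj].
  + by rewrite eqxx.
  + by rewrite dotC ogn // gtn_eqF.
  + by rewrite ogn // ltn_eqF.
  + exact: ogg.
- rewrite leq_eqVlt => /predU1P[->|]; last exact: gv.
  rewrite gram_schmidtE -/r; apply: spannedZ; rewrite -[r](subrK (v n)).
  by apply: spannedD (spanned_leq (leqnSn _) r_v) (spanned_mem _ (ltnSn _)).
- rewrite leq_eqVlt => /predU1P[->|]; last exact: vg.
  rewrite (_ : v n = `|r| *: g n + \sum_(i < n) dot (g i) (v n) *: g i); last first.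
    by rewrite gram_schmidtE scalerA mulfV // scale1r /r subrK.
  apply: spannedP; first exact: spanned_mem.
  by apply: (spanned_leq (leqnSn _)); exists (fun i => dot (g i) (v n)).
Qed.

Lemma gram_schmidt_orthonormal i j : dot (g i) (g j) = (i == j)%:R.
Proof.
by have [+ _ _] := gram_schmidt_spec (maxn i j).+1; apply; rewrite ltnS ?leq_maxl ?leq_maxr.
Qed.

Lemma spanned_gram_schmidt n u : spanned v n u <-> spanned g n u.
Proof.
have [_ gv vg] := gram_schmidt_spec n.
by split; apply: spanned_sub => i lti;
  [apply: (spanned_leq lti (vg i lti))|apply: (spanned_leq lti (gv i lti))].
Qed.

Lemma gram_schmidt_orthogonal n u : spanned v n u -> dot (g n) u = 0.
Proof.
move=> /spanned_gram_schmidt[c ->].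
by rewrite (orthonormal_dot_sum _ _ _ gram_schmidt_orthonormal) ltnn.
Qed.

Lemma gram_schmidt_total u : (forall i, dot (g i) u = 0) -> forall i, dot (v i) u = 0.
Proof.
move=> gu i; have [c ->] := (spanned_gram_schmidt i.+1 (v i)).1 (spanned_mem _ (ltnSn _)).
by rewrite dot_suml big1 // => j _; rewrite dotZl gu mulr0.
Qed.

(* A symmetric operator that is triangular on a free family is diagonal on its
   orthonormalization: [T g_n - mu_n g_n] lies in the span of
   [v_0, ..., v_{n-1}] and is orthogonal to it. *)
Lemma gram_schmidt_eigen (T : {linear V -> V}) (mu : nat -> R) :
  (forall i j, dot (T (v i)) (v j) = dot (v i) (T (v j))) ->
  (forall n, spanned v n (T (v n) - mu n *: v n)) ->
  forall n, T (g n) = mu n *: g n.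
Proof.
move=> Tsym Ttri n.
have Tv i : spanned v i.+1 (T (v i)).
  rewrite -[T _](subrK (mu i *: v i)); apply: spannedD.
    exact: (spanned_leq (leqnSn i) (Ttri i)).
  by apply: spannedZ; exact: spanned_mem.
have Tspan m u : spanned v m u -> spanned v m (T u).
  move=> [c ->]; rewrite linear_sum; apply: spanned_sum => i.
  by rewrite linearZ; apply: spannedZ; exact: (spanned_leq (ltn_ord i) (Tv i)).
have Tsymm m k u w : spanned v m u -> spanned v k w -> dot (T u) w = dot u (T w).
  move=> [c ->] [d ->]; rewrite !linear_sum !dot_suml; apply: eq_bigr => i _.
  rewrite !dot_sumr; apply: eq_bigr => j _.
  by rewrite !linearZ /= !dotZl !dotZr Tsym.
have gS : spanned v n.+1 (g n) by apply/spanned_gram_schmidt; exact: spanned_mem.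
set h := T (g n) - mu n *: g n.
suff /dot_eq0 : dot h h = 0 by move/subr0_eq.
have hn : spanned v n h.
  have [k [s sn gE]] := spannedS gS.
  have -> : h = k *: (T (v n) - mu n *: v n) + (T s - mu n *: s).
    by rewrite /h gE linearP /= scalerDr scalerBr !scalerA [mu n * k]mulrC opprD addrACA.
  by apply: spannedP => //; apply: spannedB; [exact: Tspan|exact: spannedZ].
rewrite {1}/h dotBl dotZl [dot (g n) h]gram_schmidt_orthogonal // mulr0 subr0.
by rewrite (Tsymm _ _ _ _ gS hn) gram_schmidt_orthogonal //; exact: Tspan.
Qed.

End GramSchmidt.

(** * Expansions along a total orthonormal family in a complete space *)

Section OrthonormalBasis.
Context (e : nat -> V) (e_on : forall i j, dot (e i) (e j) = (i == j)%:R)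
  (e_total : forall u, (forall i, dot (e i) u = 0) -> u = 0)
  (V_complete : forall u_ : nat -> V,
    (forall eps, 0 < eps -> exists N, forall n, (N <= n)%N -> `|u_ n - u_ N| < eps) ->
    cvgn u_).
Implicit Type c : nat -> R.

Lemma orthonormal_norm1 i : `|e i| = 1.
Proof.
by apply/eqP; rewrite -(@eqrXn2 _ 2) // -dot_norm e_on eqxx expr1n.
Qed.

Lemma orthonormal_neq0 i : e i != 0.
Proof. by rewrite -normr_eq0 orthonormal_norm1 oner_eq0. Qed.

Definition orthosum c n := \sum_(0 <= i < n) c i *: e i.

Lemma orthosum0 c : orthosum c 0 = 0.
Proof. by rewrite /orthosum big_geq. Qed.

Lemma orthosumS c n : orthosum c n.+1 = orthosum c n + c n *: e n.
Proof. by rewrite /orthosum big_nat_recr. Qed.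

Lemma continuous_orthosum (X : topologicalType) (f : X -> nat -> R) (x0 : X) n :
  (forall i, f x i @[x --> x0] --> f x0 i) ->
  orthosum (f x) n @[x --> x0] --> orthosum (f x0) n.
Proof.
move=> f_cont; elim: n => [|n IHn].
  have -> : (fun x => orthosum (f x) 0) = cst 0.
    by apply/funext => x; exact: orthosum0.
  by rewrite orthosum0; exact: cvg_cst.
have -> : (fun x => orthosum (f x) n.+1) = (fun x => orthosum (f x) n + f x n *: e n).
  by apply/funext => x; exact: orthosumS.
by rewrite orthosumS; apply: cvgD => //; exact: cvgZr_tmp.
Qed.

Lemma dot_orthosum c n j : dot (e j) (orthosum c n) = if (j < n)%N then c j else 0.
Proof. by rewrite /orthosum big_mkord; exact: orthonormal_dot_sum. Qed.

Lemma orthosumB c m n : (m <= n)%N -> orthosum c n - orthosum c m = \sum_(m <= i < n) c i *: e i.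
Proof. by move=> mn; rewrite /orthosum (big_cat_nat (n := m)) //= [LHS]addrC addKr. Qed.

Lemma norm_orthosumB c m n : (m <= n)%N ->
  `|orthosum c n - orthosum c m| ^+ 2 = \sum_(m <= i < n) c i ^+ 2.
Proof.
move=> mn; rewrite -dot_norm orthosumB //.
have dot_nat w : dot (\sum_(m <= i < n) c i *: e i) w = \sum_(m <= i < n) c i * dot (e i) w.
  under [RHS]eq_bigr do rewrite -dotZl.
  by apply: (big_morph (dot^~ w)) => [x y|]; rewrite ?dotDl ?dot0l.
rewrite dot_nat; apply: eq_big_nat => i /andP[mi ltin].
by rewrite -orthosumB // dotBr !dot_orthosum ltin ltnNge mi subr0 expr2.
Qed.

(** By Pythagoras, squared distances between partial sums are increments of a bounded nondecreasing
    real sequence, so the partial sums are Cauchy. *)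
Lemma orthosum_cvg c M : (forall n, \sum_(0 <= i < n) c i ^+ 2 <= M) -> cvgn (orthosum c).
Proof.
move=> cM; apply: V_complete => eps eps0.
pose s n := \sum_(0 <= i < n) c i ^+ 2.
have s_nd : nondecreasing_seq s.
  apply/nondecreasing_seqP => n.
  by rewrite /s big_nat_recr //= lerDl sqr_ge0.
have /cvgrPdist_lt s_cvg : cvgn s.
  apply: nondecreasing_is_cvgn => //; exists M => _ [n _ <-]; exact: cM.
have [N _ sN] : \forall n \near \oo, `|limn s - s n| < eps ^+ 2.
  by apply: s_cvg; rewrite exprn_gt0.
exists N => n Nn.
rewrite -(@ltr_pXn2r _ 2) ?nnegrE ?(ltW eps0) // norm_orthosumB //.
have -> : \sum_(N <= i < n) c i ^+ 2 = s n - s N.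
  by rewrite /s [in RHS](big_cat_nat (n := N)) //= addrAC subrr add0r.
apply: le_lt_trans (sN N (leqnn _)); apply: le_trans (ler_norm _).
rewrite lerD2r; apply: nondecreasing_cvgn_le => //.
by apply: nondecreasing_is_cvgn => //; exists M => _ [k _ <-]; exact: cM.
Qed.

Lemma bessel u n : \sum_(0 <= i < n) (dot (e i) u) ^+ 2 <= `|u| ^+ 2.
Proof.
set c := fun i => dot (e i) u.
have es : dot (orthosum c n) u = \sum_(0 <= i < n) c i ^+ 2.
  rewrite /orthosum !big_mkord dot_suml; apply: eq_bigr => i _.
  by rewrite dotZl expr2.
have := norm_orthosumB c (leq0n n); rewrite orthosum0 subr0 => nes.
have : `|u - orthosum c n| ^+ 2 = `|u| ^+ 2 - \sum_(0 <= i < n) c i ^+ 2.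
  by rewrite -dot_norm dotBl !dotBr [dot u (orthosum _ _)]dotC es !dot_norm nes subrr subr0.
by rewrite -subr_ge0 => <-.
Qed.

(** Bessel's inequality provides some limit [l]; [u - l] is orthogonal to every [e i], so totality
    forces [l = u]. *)
Lemma orthosum_dot_cvg u : orthosum (fun i => dot (e i) u) @ \oo --> u.
Proof.
have /cvg_ex[l ul] := orthosum_cvg (bessel u).
suff -> : orthosum (fun i => dot (e i) u) @ \oo --> u =
  (orthosum (fun i => dot (e i) u) @ \oo --> l) by [].
congr (_ --> _); apply/subr0_eq/e_total => i; rewrite dotBr -![dot (e i) _]dotC.
apply/eqP; rewrite subr_eq0; apply/eqP/(cvgn_unique_real _ (@dot_cvg _ _ (e i) ul)).
(* Once [n] exceeds [i], the coefficient of the partial sum on [e i] no longer changes. *)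
apply: cvg_near_cst; exists i.+1 => // n /= ltin.
by rewrite dotC dot_orthosum ltin dotC.
Qed.

Lemma orthosum_closure : closure [set u | exists n (c : nat -> R),
  u = \sum_(i < n) c i *: e i] = [set: V].
Proof.
apply/seteqP; split => // u _ A Au.
have [N _ NA] := @orthosum_dot_cvg u A Au.
exists (orthosum (fun i => dot (e i) u) N); split; last exact: NA (leqnn _).
by exists N, (fun i => dot (e i) u); rewrite /orthosum big_mkord.
Qed.

(** * Spectrum and eigenspaces of a diagonal contraction *)

Section Diagonal.
Context (T : {linear V -> V}) (mu : nat -> R)
  (T_le : forall u, `|T u| <= `|u|) (Te : forall n, T (e n) = mu n *: e n).

Lemma contraction_cvg (u_ : nat -> V) u : u_ @ \oo --> u -> T (u_ n) @[n --> \oo] --> T u.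
Proof.
move=> /cvgrPdist_lt uu; apply/cvgrPdist_lt => eps eps0.
near=> n; rewrite -linearB (le_lt_trans (T_le _)) //.
by near: n; exact: uu.
Unshelve. all: by end_near. Qed.

Lemma diagonal_cvg u : orthosum (fun i => mu i * dot (e i) u) @ \oo --> T u.
Proof.
rewrite (_ : orthosum _ = fun n => T (orthosum (fun i => dot (e i) u) n)).
  exact: (contraction_cvg (@orthosum_dot_cvg u)).
apply/funext => n; rewrite /orthosum linear_sum; apply: eq_bigr => i _.
by rewrite linearZ Te /= scalerA mulrC.
Qed.

Lemma dot_diagonal i u : dot (e i) (T u) = mu i * dot (e i) u.
Proof.
rewrite dotC; apply: (cvgn_unique_real (@dot_cvg _ _ (e i) (@diagonal_cvg u))).
apply: cvg_near_cst; exists i.+1 => // n /= ltin.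
by rewrite dotC dot_orthosum ltin.
Qed.

(** A nonzero [u] has a nonzero coefficient on some [e i], by totality; comparing that coefficient
    in [T u = l *: u] gives [l = mu i]. *)
Lemma diagonal_eigenvalue : [set l | op_eigenvalue T l] = range mu.
Proof.
apply/seteqP; split => [l [u u0 Tu]|_ [n _ <-]]; last by exists (e n); rewrite ?orthonormal_neq0.
have [i ui] : exists i, dot (e i) u != 0.
  apply/not_existsP => eu; move/negP: u0; apply; apply/eqP/e_total => i.
  by apply/eqP/negPn/negP/eu.
exists i => //; apply: (mulIf ui).
by rewrite -dot_diagonal Tu dotZr.
Qed.

(** Distinct [mu i] annihilate every coefficient of [u] except the one on [e n]. *)
Lemma diagonal_eigenspace n u : injective mu ->
  T u = mu n *: u <-> exists k : R, u = k *: e n.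
Proof.
move=> mu_inj; split => [Tu|[k ->]]; last by rewrite linearZ /= Te !scalerA mulrC.
exists (dot (e n) u); apply/eqP; rewrite -subr_eq0; apply/eqP/e_total => i.
rewrite dotBr dotZr e_on; have [->|ni] := eqVneq i n; first by rewrite mulr1 subrr.
rewrite mulr0 subr0; apply/eqP; have := dot_diagonal i u.
rewrite Tu dotZr => /eqP; rewrite -subr_eq0 -mulrBl mulf_eq0 => /orP[|//].
by rewrite subr_eq0 => /eqP/mu_inj ni'; rewrite ni' eqxx in ni.
Qed.

(** * Compactness when the eigenvalues are O(1/n) *)

Section Compact.
Context (K : R) (mu_le : forall n, `|mu n| <= K / n.+1%:R).

(** Telescoping: 1/x - 1/(x+1) exceeds 1/(x+1)^2 by exactly 1/(x (x+1)^2). *)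
Lemma sum_sq_inv_le m n : (0 < m)%N -> (m <= n)%N ->
  \sum_(m <= i < n) (i.+1%:R^-1 : R) ^+ 2 <= m%:R^-1 - n%:R^-1.
Proof.
move=> m0 /subnK <-; elim: (n - m)%N => [|k IHk].
  by rewrite add0n big_geq // subrr.
rewrite addSn big_nat_recr ?leq_addl //=.
set x : R := (k + m)%:R in IHk *; have x0 : 0 < x by rewrite ltr0n addn_gt0 m0 orbT.
suff : (k + m).+1%:R^-1 ^+ 2 <= x^-1 - (k + m).+1%:R^-1 
  by move=> H; apply: le_trans (lerD IHk H) _; rewrite addrA subrK.
rewrite -natr1 -/x -subr_ge0.
rewrite (_ : _ - _ = (x * (x + 1) ^+ 2)^-1); first by rewrite invr_ge0 mulr_ge0 ?sqr_ge0 ?ltW.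
have xn0 : x != 0 by rewrite gt_eqF.
have x1n0 : x + 1 != 0 by rewrite gt_eqF // addr_gt0.
by move: (x) xn0 x1n0 => y y0 y1; field; rewrite y0 y1.
Qed.

(** [limn] has a default value on divergent sequences, so this is meaningful only for coefficients
    whose series converges, such as those of the cube. *)
Definition diagonal_sum c := limn (orthosum (fun i => mu i * c i)).

Section CompactFamily.
Context (M : R) (M0 : 0 < M) (X : topologicalType) (c : X -> nat -> R) (A : set X)
  (cM : forall x i, A x -> `|c x i| <= M).
(** Every [muc x i] has absolute value at most [K * M / i.+1%:R] for [x] in [A]; [B] is the square
    of the numerator. *)
Let B : R := (K * M) ^+ 2.
Let muc x i := mu i * c x i.

Lemma diagonal_tail x m n : A x -> (0 < m)%N -> (m <= n)%N ->
  \sum_(m <= i < n) muc x i ^+ 2 <= B / m%:R.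
Proof.
move=> Ax m0 mn; apply: (@le_trans _ _ (B * \sum_(m <= i < n) (i.+1%:R^-1) ^+ 2)).
  rewrite mulr_sumr; apply: ler_sum => i _.
  rewrite -exprMn -[leLHS]real_normK ?num_real // lerXn2r ?nnegrE //.
    rewrite !mulr_ge0 ?invr_ge0 // ?(ltW M0) //.
    by have := le_trans (normr_ge0 _) (mu_le 0); rewrite divr1.
  by rewrite normrM mulrAC ler_pM // cM.
rewrite ler_wpM2l ?sqr_ge0 //; apply: le_trans (sum_sq_inv_le m0 mn) _.
by rewrite gerBl invr_ge0.
Qed.

Lemma diagonal_sum_cvg x : A x -> cvgn (orthosum (muc x)).
Proof.
(* The term of index 0 is kept apart because the tail estimate [B / m%:R] requires [m > 0]; it is
   applied with [m = 1]. *)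
move=> Ax; apply: (@orthosum_cvg _ ((muc x 0) ^+ 2 + B)) => -[|n].
  by rewrite big_geq // addr_ge0 ?sqr_ge0.
rewrite big_ltn // lerD2l.
have [->|n0] := posnP n; first by rewrite big_geq // sqr_ge0.
by have := @diagonal_tail x 1 n.+1 Ax isT isT; rewrite divr1.
Qed.

Lemma diagonal_sum_tail x m : A x -> (0 < m)%N ->
  `|diagonal_sum (c x) - orthosum (muc x) m| <= Num.sqrt (B / m%:R).
Proof.
move=> Ax m0; have cv := diagonal_sum_cvg Ax.
have : `|orthosum (muc x) n - orthosum (muc x) m| @[n --> \oo] -->
       `|diagonal_sum (c x) - orthosum (muc x) m|.
  by apply: cvg_norm; apply: cvgB => //; exact: cvg_cst.
move=> /cvgr_to_le; apply; exists m => // n /= mn.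
rewrite -(@ler_pXn2r _ 2) ?nnegrE ?sqrtr_ge0 //.
rewrite sqr_sqrtr ?divr_ge0 ?sqr_ge0 // norm_orthosumB //.
exact: diagonal_tail.
Qed.

(** An eps/3 argument: the tail beyond [N] is small uniformly on [A], and the remaining finite sum
    depends on finitely many continuous coordinates. *)
Lemma continuous_diagonal_sum : (forall x i, c y i @[y --> x] --> c x i) ->
  {within A, continuous (fun x => diagonal_sum (c x))}.
Proof.
move=> c_cont; apply/subspace_continuousP => x0 Ax0; apply/cvgrPdist_lt => eps eps0.
have e3 : 0 < eps / 3 by rewrite divr_gt0.
(* This [N] exceeds B / (eps/3)^2, so the tail bound sqrt(B / N) is below eps/3. *)
pose N := (Num.truncn (B / (eps / 3) ^+ 2)).+1.
have Ntail x : A x -> `|diagonal_sum (c x) - orthosum (muc x) N| < eps / 3.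
  move=> Ax; apply: le_lt_trans (diagonal_sum_tail (m := N) Ax isT) _.
  rewrite -(@ltr_pXn2r _ 2) ?nnegrE ?sqrtr_ge0 ?(ltW e3) //.
  rewrite sqr_sqrtr ?divr_ge0 ?sqr_ge0 // ltr_pdivrMr ?ltr0n // mulrC.
  by rewrite -ltr_pdivrMr ?exprn_gt0 // truncnS_gt.
have /continuous_orthosum F_cont : forall i, muc x i @[x --> x0] --> muc x0 i.
  by move=> i; apply: cvgMl_tmp; exact: c_cont.
move/cvgrPdist_lt : (F_cont N) => /(_ _ e3) {}F_cont.
near=> x; have Ax : A x by near: x; exact: withinT.
rewrite (_ : _ - _ = (diagonal_sum (c x0) - orthosum (muc x0) N) +
  (orthosum (muc x0) N - orthosum (muc x) N) -
  (diagonal_sum (c x) - orthosum (muc x) N)); last first.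
  by rewrite opprB !subrKA.
rewrite (_ : eps = eps / 3 + eps / 3 + eps / 3); last by field.
apply: le_lt_trans (ler_normB _ _) _; apply: ltrD; last exact: Ntail.
apply: le_lt_trans (ler_normD _ _) _; apply: ltrD; first exact: Ntail.
by near: x; apply: cvg_within; exact: F_cont.
Unshelve. all: by end_near. Qed.

End CompactFamily.

(* The image of a ball lies in that of the Hilbert cube [prod_i [-M, M]] under
   [c |-> sum_i mu_i c_i e_i], which is continuous because the tails of this
   series are uniformly small on the cube. *)
Lemma diagonal_compact : compact_operator T.
Proof.
move=> A /ex_strict_bound_gt0[M M0 AM].
have cube_compact := @tychonoff nat (fun=> R) (fun=> [set` `[- M, M]])
  (fun=> @segment_compact _ _ _).
have cubeM (c : prod_topology (fun _ : nat => R)) i :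
    (forall i, [set` `[- M, M]] (c i)) -> `|c i| <= M.
  by move=> /(_ i); rewrite /= in_itv /= -ler_norml.
have Phi_cont := @continuous_diagonal_sum M M0 (prod_topology (fun _ : nat => R))
  (fun c => c) [set c | forall i, [set` `[- M, M]] (c i)] cubeM
  (fun c i => @proj_continuous _ (fun=> R) i c).
have := compact_precompact (@norm_hausdorff _ V) (continuous_compact Phi_cont cube_compact).
apply: precompact_subset => _ [u Au <-].
exists (fun i => dot (e i) u); last first.
  by apply: cvg_lim; [exact: norm_hausdorff|exact: diagonal_cvg].
move=> i; rewrite /= in_itv /= -ler_norml (le_trans (dot_norm_le _ _)) //.
by rewrite orthonormal_norm1 mul1r; exact/ltW/AM.
Qed.

End Compact.
End Diagonal.
End OrthonormalBasis.
End InnerProduct.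

(** * The kernel of [L_P] *)

Section Kernel.
Context (R : realType) (a b : nat).
Local Notation mu := (@lebesgue_measure R).
Local Notation I01 := (`[0, 1]%classic : set R).
Local Notation w := (@HLweight R a b).

(** The substitution z = 1 - x t turns the domain that moves with [x] into [0, 1]. *)
Lemma integral_onemM (x : R) (G : R -> R) : 0 < x -> continuous G ->
  (\int[mu]_(z in `[(1 - x)%R, 1%R]) (G z)%:E =
   \int[mu]_(t in `[0%R, 1%R]) (x * G (1 - x * t))%:E)%E.
Proof.
move=> x0 cG; pose F (t : R) : R := 1 - x * t.
have dF t : is_derive t (1 : R) F (- x).
  by apply: is_derive_eq; rewrite /GRing.scale /= ; ring.
have F' : F^`()%classic = cst (- x).
  by apply/funext => t; rewrite derive1E derive_val.
have F_cont : continuous F.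
  by move=> t; apply/differentiable_continuous/derivable1_diffP; exact: ex_derive.
have := @integration_by_substitution_decreasing R F G 0 1 ler01.
have F0 : F 0 = 1 by rewrite /F mulr0 subr0.
have F1 : F 1 = 1 - x by rewrite /F mulr1.
rewrite F' F0 F1 => -> //.
- by apply: eq_integral => t _; congr _%:E; rewrite -[LHS]/(G (F t) * - - x) opprK mulrC.
- by move=> s t _ _ st; rewrite /F ltrD2l ltrN2 ltr_pM2l.
- by move=> t _; exact: cvg_cst.
- exact: is_cvg_cst.
- exact: is_cvg_cst.
- split; first by move=> t _; exact: ex_derive.
    by apply: cvg_at_right_filter; exact: F_cont.
  by apply: cvg_at_left_filter; exact: F_cont.
- exact: continuous_subspaceT.
Qed.

Lemma continuous_onem_powM (x : R) (p q : nat) :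
  continuous (fun z : R => (1 - z) ^+ p * (x + z - 1) ^+ q).
Proof.
have -> : (fun z : R => (1 - z) ^+ p * (x + z - 1) ^+ q) =
    horner ((1 - 'X) ^+ p * ('X + (x - 1)%:P) ^+ q).
  by apply/funext => z; rewrite hornerM !horner_exp !hornerE /=; congr (_ * _ ^+ _); ring.
exact: continuous_horner.
Qed.

(** With z = 1 - x t one has 1 - z = x t and x + z - 1 = x (1 - t): a power of x factors out and
    leaves the complete Beta integral. *)
Lemma integral_incomplete_beta (x : R) (p q : nat) : 0 < x ->
  (\int[mu]_(z in `[(1 - x)%R, 1%R]) ((1 - z) ^+ p * (x + z - 1) ^+ q)%:E =
   (x ^+ (p + q + 1) * ((p`! * q`!)%:R / (p + q).+1`!%:R))%:E)%E.
Proof.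
move=> x0; rewrite (integral_onemM x0 (@continuous_onem_powM x p q)).
rewrite -beta_fun_fact EFinM EFin_beta_fun.
have -> : (\int[mu]_y ((@XMonemX R p q \_ `[0, 1]) y)%:E =
           \int[mu]_(y in `[0%R, 1%R]) (XMonemX p q y)%:E)%E.
  rewrite [RHS]integral_mkcond; apply: eq_integral => y _.
  by rewrite /patch; case: ifP.
rewrite -integralZl //; last exact: integrable_XMonemX.
apply: eq_integral => t _; rewrite -EFinM; congr _%:E.
rewrite /XMonemX /unstable.onem.
have -> : 1 - (1 - x * t) = x * t by ring.
have -> : x + (1 - x * t) - 1 = x * (1 - t) by ring.
by rewrite !exprMn !exprD expr1; ring.
Qed.

(** The reciprocal of the Beta integral a! b! / (a+b+1)!, which makes L_P fix constants. *)
Definition LPcst : R := ((a + b + 1) * 'C(a + b, a))%:R.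

(** Exhibits [lambda] as the ratio of Beta values B(a+k+1, b+1) / B(a+1, b+1). *)
Lemma LPcst_beta (k : nat) :
  LPcst * (((a + k)`! * b`!)%:R / ((a + k) + b).+1`!%:R) = lambda R a b k.
Proof.
have fu n : n`!%:R != 0 :> R by rewrite pnatr_eq0 -lt0n fact_gt0.
have binE n m : (m <= n)%N -> 'C(n, m)%:R = n`!%:R / (m`!%:R * (n - m)`!%:R) :> R.
  by move=> mn; rewrite -(bin_fact mn) !natrM mulfK // mulf_neq0.
rewrite /LPcst /lambda natrM !binE ?leq_addr ?leq_addl //; last first.
  by rewrite -addnA addnC -addnA leq_addr.
rewrite !addKn !addnK.
have -> : (a + b + k + 1 - k = (a + b).+1)%N by rewrite addnAC addnK addn1.
have -> : (a + k + b).+1 = (a + b + k + 1)%N by rewrite addn1 addnAC.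
rewrite addn1 !factS !natrM.
move: (fu a) (fu b) (fu k) (fu (a + k)%N) (fu (a + b)%N) (fu (a + b + k + 1)%N).
have : (a + b).+1%:R != 0 :> R by rewrite pnatr_eq0.
move: ((a + b).+1%:R) (a`!%:R) (b`!%:R) (k`!%:R) ((a + k)`!%:R) ((a + b)`!%:R)
  ((a + b + k + 1)`!%:R).
move=> x1 x2 x3 x4 x5 x6 x7 h1 h2 h3 h4 h5 h6 h7.
by field; rewrite h1 h2 h3 h4 h6 h7.
Qed.

(* The symmetric density of [L_P] on the unit square: [w x * (L_P f) x] is
   [\int_z LPkernel (x, z) * f z]. *)
Definition LPkernel (p : R * R) : R :=
  if (1 <= p.1 + p.2) && ((0 <= p.1 <= 1) && (0 <= p.2 <= 1)) then
    LPcst * ((1 - p.1) ^+ a * ((1 - p.2) ^+ a * (p.1 + p.2 - 1) ^+ b))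
  else 0.
Local Notation J := LPkernel.

Lemma LPkernelC x z : J (x, z) = J (z, x).
Proof.
rewrite /LPkernel /= [z + x]addrC [in RHS](andbC (0 <= z <= 1)).
by case: ifP => // _; congr (_ * _); rewrite mulrCA.
Qed.

Lemma LPkernel_ge0 p : 0 <= J p.
Proof.
rewrite /LPkernel; case: ifP => // /and3P[+ /andP[_ +] /andP[_ +]].
rewrite -subr_ge0 => h1; rewrite -subr_ge0 => h2; rewrite -subr_ge0 => h3.
by rewrite !mulr_ge0 ?exprn_ge0 ?ler0n.
Qed.

Lemma measurable_LPkernel : measurable_fun setT J.
Proof.
apply: measurable_fun_ifT => //.
- apply: measurable_and.
    apply: measurable_fun_ler => //.
    by apply: measurable_funD; [exact: measurable_fst|exact: measurable_snd].
  by apply: measurable_and; apply: measurable_and; apply: measurable_fun_ler => //.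
- apply: measurable_funM => //.
  apply: measurable_funM; first by apply: measurable_funX; apply: measurable_funB.
  apply: measurable_funM; apply: measurable_funX; apply: measurable_funB => //.
  exact: measurable_funD.
Qed.

(** Powers of 1 - z, rather than of z, merge with the factor (1 - z)^a of the kernel and leave a
    single Beta integral. The case [k = 0] is the marginal of [J]. *)
Lemma integral_LPkernel_onemX x k : I01 x ->
  (\int[mu]_z (J (x, z) * (1 - z) ^+ k)%:E = (w x * (lambda R a b k * x ^+ k))%:E)%E.
Proof.
rewrite /= in_itv /= => /andP[x0 x1].
transitivity (\int[mu]_(z in `[(1 - x)%R, 1%R]) ((LPcst * (1 - x) ^+ a)%:E *
    ((1 - z) ^+ (a + k) * (x + z - 1) ^+ b)%:E))%E.
  rewrite [RHS]integral_mkcond; apply: eq_integral => z _.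
  rewrite /patch mem_setE in_itv /= /LPkernel /= x0 x1 /= lerBlDl.
  have [xz|] := leP 1 (x + z); last by rewrite mul0r.
  have -> : 0 <= z by move: xz x1; lra.
  rewrite /=; have [z1|] := leP z 1; last by rewrite mul0r.
  by rewrite -EFinM; congr _%:E; rewrite exprD; ring.
rewrite integralZl //; last first.
  apply: continuous_compact_integrable; first exact: segment_compact.
  exact/continuous_subspaceT/continuous_onem_powM.
(* The substitution needs x > 0. At x = 0 the domain is a single point and [w 0 = 0], since the
   exponent a + b + 1 is positive. *)
move: x0; rewrite le_eqVlt => /predU1P[<-|x0].
  rewrite subr0 set_itv1 integral_set1 mule0 /HLweight.
  by rewrite addn1 expr0n mulr0 mul0r.
rewrite integral_incomplete_beta // -EFinM; congr _%:E.
rewrite -LPcst_beta /HLweight !exprD; ring.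
Qed.

Lemma integral_LPkernelr x : I01 x -> (\int[mu]_z (J (x, z))%:E = (w x)%:E)%E.
Proof.
move=> Ix; have := @integral_LPkernel_onemX x 0 Ix.
rewrite expr0 mulr1 /lambda !bin0 divr1 mulr1 => <-.
by apply: eq_integral => z _; rewrite expr0 mulr1.
Qed.

Lemma LPkernel_out x z : ~ I01 x -> J (x, z) = 0.
Proof.
rewrite /= in_itv /= /LPkernel /= => /negP nx.
by rewrite (negbTE nx) andbF.
Qed.

Lemma measurable_LPkernel1 x : measurable_fun setT (fun z => J (x, z)).
Proof.
apply: (measurableT_comp measurable_LPkernel); exact: measurable_fun_pair.
Qed.

Lemma integrable_LPkernelr x : mu.-integrable setT (fun z => (J (x, z))%:E).
Proof.
apply/integrableP; split; first by apply/measurable_EFinP; exact: measurable_LPkernel1.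
under eq_integral do rewrite gee0_abs ?lee_fin ?LPkernel_ge0 //.
have [Ix|nIx] := pselect (I01 x); first by rewrite integral_LPkernelr // ltry.
by under eq_integral do rewrite LPkernel_out //; rewrite integral0.
Qed.

Lemma integral_LPkernelM (f : R -> R) (z : R) :
  (\int[mu]_x (J (x, z) * f z)%:E = (((fun z => (w z * f z)%:E) \_ I01) z))%E.
Proof.
under eq_integral do rewrite EFinM LPkernelC muleC.
rewrite integralZl //; last exact: integrable_LPkernelr.
rewrite patchE; have [/set_mem Iz|/negP nIz] := boolP (z \in I01).
  by rewrite integral_LPkernelr // -EFinM mulrC.
under eq_integral do rewrite (LPkernel_out _ (fun h => nIz (mem_set h))).
by rewrite integral0 mule0.
Qed.

Lemma measurable_LPkernelM (f g : R -> R) : measurable_fun setT f -> measurable_fun setT g ->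
  measurable_fun setT (fun p : R * R => (J p * (f p.2 * g p.1))%:E).
Proof.
move=> mf mg; apply/measurable_EFinP; apply: measurable_funM; first exact: measurable_LPkernel.
by apply: measurable_funM; [apply: (measurableT_comp mf)|apply: (measurableT_comp mg)].
Qed.

(** Tonelli with x integrated first: the marginal of [J] reduces the double integral of the absolute
    value to the hypothesis. *)
Lemma integrable_LPkernelM (f : R -> R) : measurable_fun setT f ->
  mu.-integrable I01 (fun x => (w x * f x)%:E) ->
  (mu \x mu)%E.-integrable setT (fun p => (J p * f p.2)%:E).
Proof.
move=> mf /integrableP[_ iwf]; apply/integrable21ltyP.
  have := measurable_LPkernelM mf (measurable_cst (1 : R)).
  by under eq_fun do rewrite mulr1.
rewrite (_ : integral _ _ _ = \int[mu]_(z in I01) `|(w z * f z)%:E|)%E //.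
rewrite [RHS]integral_mkcond; apply: eq_integral => z _.
transitivity (\int[mu]_x (J (x, z) * `|f z|)%:E)%E.
  by apply: eq_integral => x _; rewrite abse_EFin normrM ger0_norm // LPkernel_ge0.
rewrite (integral_LPkernelM (fun z => `|f z|)) !patchE; case: ifPn => // /set_mem Iz.
by rewrite abse_EFin normrM ger0_norm // HLweight_ge0.
Qed.

Lemma integral2_LPkernelM (f : R -> R) : measurable_fun setT f ->
  mu.-integrable I01 (fun x => (w x * f x)%:E) ->
  (\int[mu]_x \int[mu]_z (J (x, z) * f z)%:E = \int[mu]_(x in I01) (w x * f x)%:E)%E.
Proof.
move=> mf iwf; rewrite (Fubini (integrable_LPkernelM mf iwf)) /= [RHS]integral_mkcond.
by apply: eq_integral => z _; exact: integral_LPkernelM.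
Qed.

Lemma HLfun_cst1 : (fun=> 1) \in @HLfun R a b.
Proof.
have := @HL_monomial_subproof R a b 0.
by rewrite (_ : (fun x => x ^+ 0) = fun=> 1).
Qed.

Lemma HLfun_integrable (f : R -> R) : f \in @HLfun R a b ->
  mu.-integrable I01 (fun x => (w x * f x)%:E).
Proof.
move=> ff; apply: (@eq_integrable _ _ R mu I01 _ _ _ _ (HLfun_integrableM ff HLfun_cst1)).
  exact: measurable_itv.
by move=> x _ /=; rewrite mulr1.
Qed.

Lemma HLfun_integrable_sqr (f : R -> R) : f \in @HLfun R a b ->
  mu.-integrable I01 (fun x => (w x * f x ^+ 2)%:E).
Proof.
move=> ff; apply: (@eq_integrable _ _ R mu I01 _ _ _ _ (HLfun_integrableM ff ff)).
  exact: measurable_itv.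
by move=> x _ /=; rewrite -mulrA -expr2.
Qed.

Lemma ae_integrable_LPkernelM (f : R -> R) : f \in @HLfun R a b ->
  {ae mu, forall x, mu.-integrable setT (fun z => (J (x, z) * f z)%:E)}.
Proof.
move=> ff; apply: (@ae_integrable1 _ _ _ _ R mu mu (fun p => (J p * f p.2)%:E)).
exact: integrable_LPkernelM (HLfun_measurable ff) (HLfun_integrable ff).
Qed.

Lemma measurable_sqr (f : R -> R) : measurable_fun setT f ->
  measurable_fun setT (fun x => f x ^+ 2).
Proof. by move=> mf; exact: measurable_funX. Qed.

Lemma ae_integrable_LPkernelM_sqr (f : R -> R) : f \in @HLfun R a b ->
  {ae mu, forall x, mu.-integrable setT (fun z => (J (x, z) * f z ^+ 2)%:E)}.
Proof.
move=> ff; apply: (@ae_integrable1 _ _ _ _ R mu mu (fun p => (J p * (f p.2) ^+ 2)%:E)).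
exact: integrable_LPkernelM (measurable_sqr (HLfun_measurable ff)) (HLfun_integrable_sqr ff).
Qed.

(** * The operator on representatives *)

Definition LPmean (f : R -> R) (x : R) : R := \int[mu]_z (J (x, z) * f z).

Lemma measurable_LPmean (f : R -> R) : f \in @HLfun R a b ->
  measurable_fun setT (LPmean f).
Proof.
move=> ff; apply: (measurableT_comp (measurable_realfun.fine_measurable measurableT)).
apply: (@measurable_fubini_F _ _ _ _ R mu mu (fun p => (J p * f p.2)%:E)).
exact: integrable_LPkernelM (HLfun_measurable ff) (HLfun_integrable ff).
Qed.

(** Holds at every [x], so the value depends only on the class of [f]; points outside [0, 1] do not
    count because [J] vanishes there. *)
Lemma LPmean_ae_eq (f g : R -> R) x : measurable_fun setT f -> measurable_fun setT g ->
  ae_eq mu I01 f g -> LPmean f x = LPmean g x.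
Proof.
move=> mf mg fg; congr fine.
have mJ h : measurable_fun setT h -> measurable_fun setT (fun z => (J (x, z) * h z)%:E).
  by move=> mh; apply/measurable_EFinP/measurable_funM => //; exact: measurable_LPkernel1.
apply: ae_eq_integral => //; [exact: mJ|exact: mJ|].
apply: (@filterS _ _ (ae_filter_ringOfSetsType mu) _ _ _ fg) => z fgz _ /=.
have [Iz|nIz] := pselect (I01 z); first by rewrite fgz.
by rewrite LPkernelC LPkernel_out // !mul0r.
Qed.

(* Expand the nonnegative integral of [J (x, z) * (f z - t)^2] at the mean
   [t = LPmean f x / w x]. *)
Lemma LPmean_sqr_le (f : R -> R) x : I01 x -> 0 < w x ->
  mu.-integrable setT (fun z => (J (x, z) * f z)%:E) ->
  mu.-integrable setT (fun z => (J (x, z) * f z ^+ 2)%:E) ->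
  (LPmean f x) ^+ 2 / w x <= \int[mu]_z (J (x, z) * f z ^+ 2).
Proof.
move=> Ix w0 if1 if2; have iJ := integrable_LPkernelr x.
have wE : \int[mu]_z J (x, z) = w x by rewrite /Rintegral integral_LPkernelr.
set t := LPmean f x / w x.
have : 0 <= \int[mu]_z (J (x, z) * f z ^+ 2 - ((2 * t) * (J (x, z) * f z) - t ^+ 2 * J (x, z))).
  apply: Rintegral_ge0 => z _.
  rewrite (_ : _ - _ = J (x, z) * (f z - t) ^+ 2); last by ring.
  by rewrite mulr_ge0 ?LPkernel_ge0 ?sqr_ge0.
have i1 : mu.-integrable setT (EFin \o (fun z => (2 * t) * (J (x, z) * f z))).
  exact: (integrableZl measurableT (2 * t) if1).
have i2 : mu.-integrable setT (EFin \o (fun z => t ^+ 2 * J (x, z))).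
  exact: (integrableZl measurableT (t ^+ 2) iJ).
rewrite RintegralB //; last by have := integrableB measurableT i1 i2.
rewrite RintegralB // !RintegralZl // wE -/(LPmean f x).
have -> : LPmean f x = t * w x by rewrite /t divfK // gt_eqF.
rewrite subr_ge0; apply: le_trans; rewrite le_eqVlt; apply/orP; left; apply/eqP.
by move: (t) (w x) w0 => s v v0; field; rewrite gt_eqF.
Qed.

(** The value is fixed to 0 off the open interval; within [0, 1] this concerns only the two
    endpoints, where [w] may vanish. *)
Definition LPop (f : R -> R) (x : R) : R := if 0 < x < 1 then LPmean f x / w x else 0.

Lemma measurable_LPop (f : R -> R) : f \in @HLfun R a b ->
  measurable_fun setT (LPop f).
Proof.
move=> ff.
(* Division is rewritten as a real power of exponent -1, which is a measurable function. *)
have -> : LPop f = (fun x => if 0 < x < 1 then LPmean f x * w x `^ (-1) else 0).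
  apply/funext => x; rewrite /LPop; case: ifP => // x01.
  by rewrite powR_inv1 // ltW // HLweight_gt0.
apply: measurable_fun_ifT => //.
  by apply: measurable_and; apply: measurable_fun_ltr.
apply: measurable_funM; first exact: measurable_LPmean.
by apply: (measurableT_comp (measurable_powR _)); exact: measurable_HLweight.
Qed.

(** Integrates the pointwise Jensen bound [LPmean_sqr_le] and applies the other marginal of [J].
    Stating it in [\bar R] lets it also prove that [LPop f] has finite norm. *)
Lemma LPop_sqr_le (f : R -> R) : f \in @HLfun R a b ->
  (\int[mu]_(x in I01) (w x * LPop f x * LPop f x)%:E <=
   \int[mu]_(x in I01) (w x * f x * f x)%:E)%E.
Proof.
move=> ff; have mf := HLfun_measurable ff.
have mJ2 : measurable_fun setT (fun p : R * R => (J p * f p.2 ^+ 2)%:E).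
  by have := measurable_LPkernelM (measurable_sqr mf) (measurable_cst (1 : R));
    under eq_fun do rewrite mulr1.
have mQ : measurable_fun setT (fun x => \int[mu]_z (J (x, z) * f z ^+ 2)%:E)%E.
  apply: (@measurable_fun_fubini_tonelli_F _ _ _ _ R mu (fun p => (J p * f p.2 ^+ 2)%:E)) => //.
  by move=> p; rewrite lee_fin mulr_ge0 ?LPkernel_ge0 ?sqr_ge0.
have Q0 x : (0 <= \int[mu]_z (J (x, z) * f z ^+ 2)%:E)%E.
  by apply: integral_ge0 => z _; rewrite lee_fin mulr_ge0 ?LPkernel_ge0 ?sqr_ge0.
apply: (@le_trans _ _ (\int[mu]_(x in I01) \int[mu]_z (J (x, z) * f z ^+ 2)%:E)%E).
  apply: ae_ge0_le_integral => //.
  - by move=> x Ix; rewrite lee_fin -mulrA -expr2 mulr_ge0 ?sqr_ge0 ?HLweight_ge0.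
  - by apply: measurable_HLweightM; exact: measurable_LPop.
  - exact: measurable_funTS.
  - apply: (@filterS3 _ _ (ae_filter_ringOfSetsType mu) _ _ _ _ _ (@ae_01 R)
      (ae_integrable_LPkernelM ff) (ae_integrable_LPkernelM_sqr ff)).
    move=> x x01 if1 if2 Ix; rewrite -(fineK (integrable_fin_num measurableT if2)) lee_fin.
    have w0 := @HLweight_gt0 R a b x (x01 Ix).
    apply: le_trans (LPmean_sqr_le Ix w0 if1 if2); rewrite /LPop x01 // le_eqVlt.
    apply/orP; left; apply/eqP; move: (LPmean f x) (w x) w0 => m v v0.
    by field; rewrite gt_eqF.
have -> : (\int[mu]_(x in I01) (w x * f x * f x)%:E =
    \int[mu]_(x in I01) (w x * f x ^+ 2)%:E)%E.
  by apply: eq_integral => x _; rewrite -mulrA -expr2.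
rewrite -(integral2_LPkernelM (measurable_sqr mf) (HLfun_integrable_sqr ff)).
by apply: ge0_subset_integral.
Qed.

Lemma LPop_HLfun (f : R -> R) : f \in @HLfun R a b -> LPop f \in @HLfun R a b.
Proof.
move=> ff; have mLf := measurable_LPop ff; apply/HLfunP; split => //.
apply/integrableP; split; first exact: measurable_HLweightM.
under eq_integral.
  move=> x /set_mem Ix; rewrite gee0_abs; last first.
    by rewrite lee_fin -mulrA -expr2 mulr_ge0 ?sqr_ge0 ?HLweight_ge0.
  over.
apply: le_lt_trans (LPop_sqr_le ff) _.
by have := HLfun_integrableM ff ff; exact: integrable_lty.
Qed.

Lemma LPkernelM_integrand (f : R -> R) x z : 0 < x < 1 -> `[1 - x, 1]%classic z ->
  J (x, z) * f z = LPcst * w x * LP_integrand a b f x z.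
Proof.
move=> /andP[x0 x1]; rewrite /= in_itv /= lerBlDl => /andP[xz z1].
have z0 : 0 <= z by move: xz x1; lra.
rewrite /LPkernel /= xz (ltW x0) (ltW x1) z0 z1 /= /LP_integrand /HLweight.
have xn0 : x ^+ (a + b + 1) != 0 by rewrite expf_neq0 ?gt_eqF.
move: ((x + z - 1) ^+ b) (x ^+ (a + b + 1)) xn0 => p q q0.
by field.
Qed.

Lemma LPkernel_outl x z : ~ `[1 - x, 1]%classic z -> J (x, z) = 0.
Proof.
move=> nz; rewrite /LPkernel; case: ifPn => //= /and3P[xz _ /andP[_ z1]].
by exfalso; apply: nz; rewrite /= in_itv /= z1 lerBlDl xz.
Qed.

Lemma LPop_integrand (f : R -> R) x : 0 < x < 1 ->
  mu.-integrable setT (fun z => (J (x, z) * f z)%:E) ->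
  mu.-integrable `[1 - x, 1]%classic (fun z => (LP_integrand a b f x z)%:E) /\
  LPop f x = LP_fun a b f x.
Proof.
move=> x01 if1; have w0 := @HLweight_gt0 R a b x x01.
have c0 : 0 < LPcst.
  by rewrite ltr0n muln_gt0 addn1 /= bin_gt0 leq_addr.
have cw0 : LPcst * w x != 0 by rewrite mulf_neq0 ?gt_eqF.
have if2 : mu.-integrable `[1 - x, 1]%classic (fun z => (LP_integrand a b f x z)%:E).
  have : mu.-integrable `[1 - x, 1]%classic (fun z => (J (x, z) * f z)%:E).
    by apply: integrableS if1.
  move=> /(integrableZl _ (LPcst * w x)^-1) => /(_ (measurable_itv _)).
  apply: eq_integrable => // z /set_mem Iz /=.
  by rewrite -EFinM LPkernelM_integrand // mulKf.
split => //; rewrite /LPop x01 /LPmean /LP_fun.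
have -> : \int[mu]_z (J (x, z) * f z) =
    \int[mu]_(z in `[1 - x, 1]%classic) (LPcst * w x * LP_integrand a b f x z).
  rewrite [RHS]Rintegral_mkcond; apply: eq_Rintegral => z _; rewrite patchE.
  case: ifPn => [/set_mem Iz|/negP nIz]; first exact: LPkernelM_integrand.
  by rewrite LPkernel_outl ?mul0r // => Iz; apply: nIz; exact: mem_set.
by rewrite RintegralZl // [LPcst * w x * _]mulrAC mulfK ?gt_eqF.
Qed.

(** * The operator on classes: linearity, contraction, symmetry *)

Definition LP_rep (f : HLrep R a b) : HLrep R a b := MkHLrep (LPop_HLfun (HLvalP f)).

Definition LP_HL (u : HL R a b) : HL R a b := \pi_(HL R a b)%qT (LP_rep (repr u)).

Lemma LPop_ae_eq (f g : HLrep R a b) : ae_eq mu I01 f g -> LPop f =1 LPop g.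
Proof.
move=> fg x; rewrite /LPop; case: ifP => // _.
by rewrite (LPmean_ae_eq _ _ _ fg) //; apply: HLfun_measurable; exact: HLvalP.
Qed.

Lemma LP_HL_pi (f : HLrep R a b) : LP_HL (\pi_(HL R a b)%qT f) = \pi_(HL R a b)%qT (LP_rep f).
Proof.
apply/HL_eqP/aeW => x _; exact: (LPop_ae_eq (@repr_pi _ _ _ f)).
Qed.

Lemma LP_HL_linear : linear LP_HL.
Proof.
move=> k u v; rewrite -[u]reprK -[v]reprK; move: (repr u) (repr v) => f g.
have -> : k *: \pi_(HL R a b)%qT f + \pi_(HL R a b)%qT g = \pi_(HL R a b)%qT (k *: f + g).
  by rewrite HL_piD HL_piZ.
rewrite !LP_HL_pi.
have -> : k *: \pi_(HL R a b)%qT (LP_rep f) + \pi_(HL R a b)%qT (LP_rep g) =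
    \pi_(HL R a b)%qT (k *: LP_rep f + LP_rep g).
  by rewrite HL_piD HL_piZ.
(* The integrals are additive where both exist, which Fubini guarantees for almost every x. *)
apply/HL_eqP; apply: (@filterS2 _ _ (ae_filter_ringOfSetsType mu) _ _ _ _
  (ae_integrable_LPkernelM (HLvalP f)) (ae_integrable_LPkernelM (HLvalP g))).
move=> x if1 ig1 _; rewrite -[LHS]/(LPop (k *: f + g) x).
rewrite -[RHS]/(k * LPop f x + LPop g x) /LPop; case: ifP => _; last by rewrite mulr0 addr0.
rewrite mulrA -mulrDl; congr (_ / _); rewrite /LPmean -RintegralZl // -RintegralD //.
  apply: eq_Rintegral => z _.
  by rewrite -[(k *: f + g) z]/(k * f z + g z); ring.
exact: (integrableZl measurableT k if1).
Qed.

HB.instance Definition _ := GRing.isLinear.Build R (HL R a b) (HL R a b) _ LP_HL LP_HL_linear.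

Lemma LP_HL_norm u : `|LP_HL u| <= `|u|.
Proof.
rewrite -[u]reprK; move: (repr u) => f; rewrite LP_HL_pi.
rewrite -[leLHS]/(HLnorm _) -[leRHS]/(HLnorm _) /HLnorm; apply: ler_wsqrtr.
rewrite !HLdot_pi /Rintegral fine_le //; last exact: LPop_sqr_le (HLvalP f).
  by apply: integrable_fin_num => //; apply: HLfun_integrableM; exact: HLvalP.
by apply: integrable_fin_num => //; apply: HLfun_integrableM; exact: HLvalP.
Qed.

Lemma LP_HL_is_LP : is_LP LP_HL.
Proof.
move=> f; split.
  apply: (@filterS2 _ _ (ae_filter_ringOfSetsType mu) _ _ _ _
    (@ae_01 R) (ae_integrable_LPkernelM (HLvalP f))) => x x01 if1 Ix.
  by have [] := LPop_integrand (x01 Ix) if1.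
rewrite LP_HL_pi; apply: (@filterS3 _ _ (ae_filter_ringOfSetsType mu) _ _ _ _ _ 
    (@ae_01 R) (ae_integrable_LPkernelM (HLvalP f)) (@repr_pi _ _ _ (LP_rep f))) => x x01 if1 + Ix.
by move=> /(_ Ix) ->; have [_ <-] := LPop_integrand (x01 Ix) if1.
Qed.

(** |f(z) g(x)| is at most f(z)^2 + g(x)^2; the first square is integrable against [J] by its
    marginal, the second by the symmetry of [J]. *)
Lemma integrable_LPkernelM2 (f g : HLrep R a b) :
  (mu \x mu)%E.-integrable setT (fun p => (J p * (f p.2 * g p.1))%:E).
Proof.
have mf := HLfun_measurable (HLvalP f); have mg := HLfun_measurable (HLvalP g).
have i2 (h : HLrep R a b) := integrable_LPkernelM (measurable_sqr (HLfun_measurable (HLvalP h)))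
  (HLfun_integrable_sqr (HLvalP h)).
have i1 : (mu \x mu)%E.-integrable setT (fun p => (J p * g p.1 ^+ 2)%:E).
  apply/integrable12ltyP.
    have := measurable_LPkernelM (measurable_cst (1 : R)) (measurable_sqr mg).
    by under eq_fun do rewrite mul1r.
  have /integrable21ltyP := i2 g => /(_ (measurable_int _ (i2 g))).
  apply: le_lt_trans; rewrite le_eqVlt; apply/orP; left; apply/eqP.
  apply: eq_integral => x _; apply: eq_integral => z _ /=.
  by rewrite LPkernelC.
apply: (le_integrable measurableT _ _ (integrableD measurableT (i2 f) i1)).
  exact: measurable_LPkernelM.
move=> p _; rewrite -EFinD !abse_EFin lee_fin -mulrDr.
rewrite !normrM !(ger0_norm (LPkernel_ge0 p)) ler_wpM2l ?LPkernel_ge0 //.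
rewrite [leRHS]ger0_norm ?addr_ge0 ?sqr_ge0 //.
rewrite -(real_normK (num_real (f p.2))) -(real_normK (num_real (g p.1))).
by have := normr_ge0 (f p.2); have := normr_ge0 (g p.1); nra.
Qed.

(** The weight of the inner product cancels the division by [w] in [LPop], leaving a form whose
    symmetry is that of [J]. *)
Lemma HLdot_LP_HL (f g : HLrep R a b) :
  HLdot (LP_HL (\pi_(HL R a b)%qT f)) (\pi_(HL R a b)%qT g) =
  fine (\int[mu]_x \int[mu]_z (J (x, z) * (f z * g x))%:E)%E.
Proof.
rewrite LP_HL_pi HLdot_pi; congr fine; rewrite integral_mkcond.
apply: ae_eq_integral => //.
- apply/(measurable_restrictT _ _).1 => //; apply: measurable_HLweightM.
    exact: measurable_LPop (HLvalP f).
  exact: HLfun_measurable (HLvalP g).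
- exact: (measurable_fubini_F (integrable_LPkernelM2 f g)).
apply: (@filterS2 _ _ (ae_filter_ringOfSetsType mu) _ _ _ _
  (@ae_01 R) (ae_integrable_LPkernelM (HLvalP f))) => x x01 if1 _.
rewrite patchE; case: ifPn => [/set_mem Ix|/negP nIx]; last first.
  under eq_integral do rewrite (LPkernel_out _ (fun h => nIx (mem_set h))) mul0r.
  by rewrite integral0.
under [RHS]eq_integral do rewrite mulrA mulrC EFinM.
rewrite integralZl // -[X in (_ * X)%E]fineK ?integrable_fin_num // -EFinM; congr _%:E.
rewrite -[LP_rep f x]/(LPop f x) /LPop x01 // -[fine _]/(LPmean f x).
have := @HLweight_gt0 R a b x (x01 Ix); move: (w x) (LPmean f x) (g x) => v m y v0.
by field; rewrite gt_eqF.
Qed.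

Lemma LP_HL_symmetric u v : HLdot (LP_HL u) v = HLdot u (LP_HL v).
Proof.
rewrite [RHS]HLdotC -[u]reprK -[v]reprK; move: (repr u) (repr v) => f g.
rewrite !HLdot_LP_HL; congr fine.
rewrite (Fubini (integrable_LPkernelM2 f g)) /=.
apply: eq_integral => x _; apply: eq_integral => z _.
by rewrite LPkernelC [f _ * _]mulrC.
Qed.

(** * Action on the monomials, and their linear independence *)

Lemma HL_pi_sum n (k : 'I_n -> R) (f : 'I_n -> HLrep R a b) :
  \pi_(HL R a b)%qT (\sum_(i < n) k i *: f i) = \sum_(i < n) k i *: \pi_(HL R a b)%qT (f i).
Proof.
elim/big_rec2 : _ => [|i u v _ <-]; last by rewrite HL_piD HL_piZ.
by apply: (addrI (\pi_(HL R a b)%qT 0)); rewrite -HL_piD !addr0.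
Qed.

Lemma HLval_sum n (k : 'I_n -> R) (f : 'I_n -> HLrep R a b) x :
  (\sum_(i < n) k i *: f i : HLrep R a b) x = \sum_(i < n) k i * f i x.
Proof. by elim/big_rec2 : _ => // i u v _ <-. Qed.

Lemma integrable_LPkernel_onemX x k : I01 x ->
  mu.-integrable setT (fun z => (J (x, z) * (1 - z) ^+ k)%:E).
Proof.
move=> Ix; apply/integrableP; split.
  apply/measurable_EFinP; apply: measurable_funM; first exact: measurable_LPkernel1.
  by apply: measurable_funX; exact: measurable_funB.
under eq_integral.
  move=> z _; rewrite gee0_abs; last first.
    rewrite lee_fin; have [Iz|nIz] := pselect (I01 z); last first.
      by rewrite LPkernelC LPkernel_out // mul0r.
    rewrite mulr_ge0 ?LPkernel_ge0 // exprn_ge0 // subr_ge0.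
    by move: Iz; rewrite /= in_itv => /andP[].
  over.
by rewrite integral_LPkernel_onemX // ltry.
Qed.

(** Write z^n = (1 - (1 - z))^n: L_P sends (1 - z)^k to lambda_k x^k, so the reflection z -> 1 - z
    is what produces the signs. *)
Lemma LPop_monomial n x : 0 < x < 1 ->
  LPop (fun x => x ^+ n) x = \sum_(k < n.+1) (-1) ^+ k *+ 'C(n, k) * lambda R a b k * x ^+ k.
Proof.
move=> x01; have Ix : I01 x by rewrite /= in_itv /= !ltW //; case/andP: x01.
have w0 := @HLweight_gt0 R a b x x01.
rewrite /LPop x01; apply: (mulIf (lt0r_neq0 w0)); rewrite divfK ?gt_eqF // mulr_suml.
rewrite /LPmean /Rintegral.
have -> : (\int[mu]_z (J (x, z) * z ^+ n)%:E = \int[mu]_z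
    \sum_(k < n.+1) ((-1) ^+ k *+ 'C(n, k))%:E * (J (x, z) * (1 - z) ^+ k)%:E)%E.
  apply: eq_integral => z _; rewrite sumEFin; congr _%:E.
  transitivity (J (x, z) * (1 - (1 - z : R)) ^+ n); first by rewrite subKr.
  rewrite exprBn mulr_sumr; apply: eq_bigr => k _.
  by rewrite expr1n mulr1 mulrnAr mulrCA mulrnAl.
rewrite integral_sum // => [|k]; last first.
  exact: (integrableZl measurableT ((-1) ^+ k *+ 'C(n, k)) (integrable_LPkernel_onemX k Ix)).
under eq_bigr.
  move=> k _; rewrite integralZl //; last exact: integrable_LPkernel_onemX.
  rewrite integral_LPkernel_onemX // -EFinM; over.
by rewrite sumEFin /=; apply: eq_bigr => k _; ring.
Qed.

Lemma LP_HL_monomial n : LP_HL (HL_monomial R a b n) =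
  \sum_(k < n.+1) ((-1) ^+ k *+ 'C(n, k) * lambda R a b k) *: HL_monomial R a b k.
Proof.
rewrite -HL_pi_sum LP_HL_pi; apply/HL_eqP.
apply: (@filterS _ _ (ae_filter_ringOfSetsType mu) _ _ _ (@ae_01 R)) => x x01 Ix.
by rewrite HLval_sum -[LHS]/(LPop (fun x => x ^+ n) x) LPop_monomial // x01.
Qed.

(** A nonzero value would persist on a ball inside the interval, which has positive measure. *)
Lemma ae_eq_continuous01 (f : R -> R) : continuous f -> ae_eq mu I01 f (cst 0) ->
  forall x, 0 < x < 1 -> f x = 0.
Proof.
move=> cf f0 x x01; apply/eqP/negP => /negP fx.
have : \forall y \near x, f y != 0 by exact: (cvgr_neq0 _ (cf x) fx).
have : nbhs x [set y | 0 < y < 1].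
  by apply: (@near_in_itvoo _ 0 1 x); rewrite in_itv.
move=> /filterI /[apply] /nbhs_ballP[e /= e0 xe].
have [N [mN N0 fN]] := f0.
have : (mu (ball x e) <= mu N)%E.
  apply: le_measure; rewrite ?inE //; first exact: measurable_ball.
  move=> y /xe[y01 fy]; apply: fN => /= /(_ _) fy0; move/eqP : fy; apply; apply: fy0.
  by rewrite /= in_itv /= !ltW //; case/andP: y01.
rewrite N0 lebesgue_measure_ball ?(ltW e0) // lee_fin leNgt => /negP; apply.
by rewrite pmulrn_lgt0.
Qed.

Lemma HL_monomial_free n (c : nat -> R) :
  HL_monomial R a b n <> \sum_(i < n) c i *: HL_monomial R a b i.
Proof.
rewrite -HL_pi_sum => /HL_eqP e.
pose p : {poly R} := 'X^n - \poly_(i < n) c i.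
have pE x : p.[x] = x ^+ n - \sum_(i < n) c i * x ^+ i.
  by rewrite hornerD hornerN hornerXn horner_poly.
have p0 : p != 0.
  by rewrite -size_poly_eq0 size_polyDl ?size_polyXn ?size_polyN ?ltnS ?size_poly.
have p_root x : 0 < x < 1 -> root p x.
  move=> x01; apply/eqP; apply: ae_eq_continuous01 x01; first exact: continuous_horner.
  apply: (@filterS _ _ (ae_filter_ringOfSetsType mu) _ _ _ e) => y + Iy.
  by move=> /(_ Iy); rewrite HLval_sum pE -[MkHLrep _ y]/(y ^+ n) => ->; rewrite subrr.
(* [size p] distinct points of the open interval: more roots than a nonzero [p] can have. *)
pose s := [seq (i.+2%:R : R)^-1 | i <- iota 0 (size p)].
have := max_poly_roots (rs := s) p0; rewrite size_map size_iota ltnn => H.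
suff : false by []; apply: H.
  apply/allP => _ /mapP[i _ ->]; apply: p_root.
  by rewrite invr_gt0 ltr0n /= invf_lt1 ?ltr0n // ltr1n.
by rewrite map_inj_uniq ?iota_uniq // => i j /invr_inj/eqP; rewrite eqr_nat => /eqP[].
Qed.

End Kernel.

(** * Completeness of [H_L] *)

Section Completeness.
Context (R : realType) (a b : nat).
Local Notation mu := (@lebesgue_measure R).
Local Notation I01 := (`[0, 1]%classic : set R).
Local Notation w := (@HLweight R a b).
Local Notation piHL f := (\pi_(HL R a b)%qT f).

Lemma limn_einf_le (u : (\bar R)^nat) (B : \bar R) k :
  (forall m, (k <= m)%N -> (u m <= B)%E) -> (limn_einf u <= B)%E.
Proof.
move=> uB; rewrite limn_einf_lim; apply: lime_le; first exact: is_cvg_einfs.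
apply: nearW => n; apply: (@le_trans _ _ (u (maxn n k))); last exact/uB/leq_maxr.
by apply: ereal_inf_lbound; exists (maxn n k) => //=; exact: leq_maxl.
Qed.

Lemma measurable_limn_einf (D : set R) (f : (R -> \bar R)^nat) :
  (forall n, measurable_fun D (f n)) -> measurable_fun D (fun x => limn_einf (f^~ x)).
Proof.
move=> mf; have -> : (fun x => limn_einf (f^~ x)) = (fun x => - limn_esup (fun n => - f n x))%E.
  by apply/funext => x; rewrite -limn_einfN; congr limn_einf; apply/funext => n /=; rewrite oppeK.
apply: measurableT_comp => //.
by apply: (measurable_fun_limn_esup (f := fun n x => - f n x)%E) => n; apply: measurableT_comp.
Qed.

Lemma HLdot_norm (u : HL R a b) : HLdot u u = `|u| ^+ 2.
Proof. by rewrite -[`|u|]/(Num.sqrt _) sqr_sqrtr // HLdot_ge0. Qed.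

Lemma integral_HLnorm (f : HLrep R a b) :
  (\int[mu]_(x in I01) (w x * f x * f x)%:E = (`|piHL f| ^+ 2)%:E)%E.
Proof.
rewrite -HLdot_norm HLdot_pi fineK //; apply: integrable_fin_num => //.
by apply: HLfun_integrableM; exact: HLvalP.
Qed.

Lemma HLfun_normr (f : R -> R) : f \in @HLfun R a b -> (fun x => `|f x|) \in @HLfun R a b.
Proof.
move=> /HLfunP[mf wf]; apply/HLfunP; split; first exact: measurableT_comp.
have : mu.-integrable I01 (fun x => (w x * f x * f x)%:E) by [].
apply: eq_integrable => // x _; congr _%:E.
by rewrite -!mulrA -!expr2 real_normK ?num_real.
Qed.

(** Cauchy-Schwarz against the constant 1; it turns norm estimates into weighted L^1 estimates, from
    which convergence almost everywhere follows. *)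
Lemma integral_normr_le (f : HLrep R a b) :
  (\int[mu]_(x in I01) (w x * `|f x|)%:E <= (`|piHL f| * `|HL_monomial R a b 0|)%:E)%E.
Proof.
pose g := MkHLrep (HLfun_normr (HLvalP f)).
have gE : `|piHL g| = `|piHL f|.
  apply/eqP; rewrite -(@eqrXn2 _ 2) // -!HLdot_norm !HLdot_pi; apply/eqP.
  by apply: eq_Rintegral => x _; rewrite -!mulrA -!expr2 /= real_normK ?num_real.
rewrite -gE; have := HL_cauchy_schwarz (piHL g) (HL_monomial R a b 0).
rewrite -lee_fin; apply: le_trans; rewrite HLdot_pi fineK; last first.
  by apply: integrable_fin_num => //; apply: HLfun_integrableM; exact: HLvalP.
rewrite le_eqVlt; apply/orP; left; apply/eqP/eq_integral => x _.
by rewrite -[RHS]/((w x * `|f x| * x ^+ 0)%:E) expr0 mulr1.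
Qed.

Let h : R := 2^-1.

Lemma sum_half n : \sum_(0 <= k < n) h ^+ k <= 2.
Proof.
suff -> : \sum_(0 <= k < n) h ^+ k = 2 - 2 * h ^+ n by rewrite gerBl mulr_ge0 ?exprn_ge0 ?invr_ge0.
elim: n => [|n IHn]; first by rewrite big_geq // expr0 mulr1 subrr.
by rewrite big_nat_recr //= IHn exprS mulrA divff // mul1r; ring.
Qed.

Section FastCauchy.
Context (f : nat -> HLrep R a b)
  (f_fast : forall k m, (k <= m)%N -> `|piHL (f m) - piHL (f k)| <= 2 * h ^+ k).

Lemma piHLB (g1 g2 : HLrep R a b) : piHL (g1 - g2) = piHL g1 - piHL g2.
Proof.
by have := HL_piD (g1 - g2) g2; rewrite subrK => ->; rewrite addrK.
Qed.

(** The weighted sum of the absolute increments is integrable, hence finite almost everywhere; where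
    [w] is positive the telescoping series then converges absolutely. *)
Lemma fast_cauchy_ae_cvg : {ae mu, forall x, I01 x -> cvgn (fun k => f k x)}.
Proof.
pose C := `|HL_monomial R a b 0|.
pose s (x : R) := (\sum_(0 <= k <oo) (w x * `|f k.+1 x - f k x|)%:E)%E.
have mf k : measurable_fun setT (f k) := HLfun_measurable (HLvalP (f k)).
have mt k : measurable_fun I01 (fun x => (w x * `|f k.+1 x - f k x|)%:E).
  apply/measurable_EFinP; apply: measurable_funM; first exact: measurable_HLweight.
  by apply: measurable_funTS; apply: measurableT_comp => //; exact: measurable_funB.
have t0 k x : I01 x -> (0 <= (w x * `|f k.+1 x - f k x|)%:E)%E.
  by move=> Ix; rewrite lee_fin mulr_ge0 ?HLweight_ge0.
have s0 x : I01 x -> (0 <= s x)%E by move=> Ix; apply: nneseries_ge0 => k _ _; exact: t0.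
have ms : measurable_fun I01 s by apply: ge0_emeasurable_sum => // k x Ix _; exact: t0.
have : mu.-integrable I01 s.
  apply/integrableP; split => //.
  under eq_integral.
    move=> x /set_mem Ix; rewrite (gee0_abs (s0 x Ix)); over.
  (* Increments have norm at most [2 * h ^+ k], the [h ^+ k] sum to at most 2, and [C] is the norm
     of 1. *)
  rewrite integral_nneseries //; apply: (@le_lt_trans _ _ (4 * C)%:E); last exact: ltry.
  apply: lime_le; first by apply: is_cvg_nneseries => k _ _; apply: integral_ge0 => x; exact: t0.
  apply: nearW => n; apply: (@le_trans _ _ (\sum_(0 <= k < n) (2 * h ^+ k * C)%:E)%E).
    apply: lee_sum => k _; apply: le_trans (integral_normr_le (f k.+1 - f k)) _.
    by rewrite lee_fin ler_wpM2r // piHLB f_fast.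
  rewrite sumEFin lee_fin -mulr_suml -mulr_sumr ler_wpM2r ?normr_ge0 //.
  by have := sum_half n; lra.
move=> ints; have sfin : {ae mu, forall x, I01 x -> s x \is a fin_num}.
  by apply: integrable_ae ints; exact: measurable_itv.
apply: (@filterS2 _ _ (ae_filter_ringOfSetsType mu) _ _ _ _ (@ae_01 R) sfin) => x x01 + Ix.
move=> /(_ Ix); rewrite ge0_fin_numE ?s0 // => sx.
have wx := @HLweight_gt0 R a b x (x01 Ix).
have := nnseries_is_cvg (fun k => mulr_ge0 (ltW wx) (normr_ge0 (f k.+1 x - f k x))) sx.
rewrite (_ : series _ = fun n => w x * [normed series (telescope (fun k => f k x))] n); last first.
  by apply/funext => n; rewrite /series /= mulr_sumr.
move=> wc; have : cvgn (fun n => (w x)^-1 * (w x * [normed series (telescope (fun k => f k x))] n)).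
  by apply: is_cvgM => //; exact: is_cvg_cst.
rewrite (_ : (fun n => _) = [normed series (telescope (fun k => f k x))]); last first.
  by apply/funext => n; rewrite mulrA mulVf ?mul1r ?gt_eqF.
move=> /normed_cvg; rewrite -[X in _ -> X]/(cvgn (fun k => f k x)) => cf.
rewrite (_ : (fun k => f k x) = fun n => f 0%N x + series (telescope (fun k => f k x)) n).
  by apply: is_cvgD => //; exact: is_cvg_cst.
by apply/funext => n; rewrite telescopeK addrC subrK.
Qed.

(** The upper limit is measurable on the whole line, whereas the limit itself is known to exist only
    almost everywhere on [0, 1]. *)
Definition fast_cauchy_lim (x : R) : R := fine (limn_esup (fun k => (f k x)%:E)).

Lemma measurable_fast_cauchy_lim : measurable_fun setT fast_cauchy_lim.
Proof.
apply: (measurableT_comp (fine_measurable measurableT)).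
apply: (measurable_fun_limn_esup (f := fun k x => (f k x)%:E)) => k.
by apply/measurable_EFinP; exact: HLfun_measurable (HLvalP (f k)).
Qed.

Lemma fast_cauchy_limE : {ae mu, forall x, I01 x -> f k x @[k --> \oo] --> fast_cauchy_lim x}.
Proof.
apply: (@filterS _ _ (ae_filter_ringOfSetsType mu) _ _ _ fast_cauchy_ae_cvg) => x + Ix.
move=> /(_ Ix)/cvg_ex[l fl]; rewrite /fast_cauchy_lim.
have /cvg_limn_einf_sup[_ ->] : (f k x)%:E @[k --> \oo] --> l%:E.
  by apply: cvg_EFin => //; exact: nearW.
exact: fl.
Qed.

(** Fatou's lemma in the first index with [k] held fixed. *)
Lemma fast_cauchy_lim_le k :
  (\int[mu]_(x in I01) (w x * (fast_cauchy_lim x - f k x) * (fast_cauchy_lim x - f k x))%:E <=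
   ((2 * h ^+ k) ^+ 2)%:E)%E.
Proof.
have mf n : measurable_fun setT (f n) := HLfun_measurable (HLvalP (f n)).
have mh n : measurable_fun I01 (fun x => (w x * (f n x - f k x) * (f n x - f k x))%:E).
  by apply: measurable_HLweightM; exact: measurable_funB.
have h0 n x : I01 x -> (0 <= (w x * (f n x - f k x) * (f n x - f k x))%:E)%E.
  by move=> Ix; rewrite lee_fin -mulrA -expr2 mulr_ge0 ?sqr_ge0 ?HLweight_ge0.
have -> : (\int[mu]_(x in I01)
      (w x * (fast_cauchy_lim x - f k x) * (fast_cauchy_lim x - f k x))%:E =
    \int[mu]_(x in I01) limn_einf (fun n => (w x * (f n x - f k x) * (f n x - f k x))%:E))%E.
  apply: ae_eq_integral => //.
  - by apply: measurable_HLweightM; apply: measurable_funB => //; exact: measurable_fast_cauchy_lim.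
  - exact: measurable_limn_einf.
  apply: (@filterS _ _ (ae_filter_ringOfSetsType mu) _ _ _ fast_cauchy_limE) => x + Ix.
  move=> /(_ Ix) fl; apply/esym.
  suff /cvg_limn_einf_sup[] : (w x * (f n x - f k x) * (f n x - f k x))%:E @[n --> \oo] -->
    (w x * (fast_cauchy_lim x - f k x) * (fast_cauchy_lim x - f k x))%:E by [].
  apply: cvg_EFin; first exact: nearW.
  have fB : (f n x - f k x) @[n --> \oo] --> (fast_cauchy_lim x - f k x).
    by apply: cvgB => //; exact: cvg_cst.
  by apply: cvgM => //; apply: cvgM => //; exact: cvg_cst.
apply: le_trans (fatou mu _ mh h0) _ => //.
apply: (@limn_einf_le _ _ k) => m km.
have -> : (\int[mu]_(x in I01) (w x * (f m x - f k x) * (f m x - f k x))%:E =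
    (`|piHL (f m - f k)| ^+ 2)%:E)%E by exact: integral_HLnorm (f m - f k).
by rewrite lee_fin lerXn2r ?nnegrE ?mulr_ge0 ?exprn_ge0 ?invr_ge0 // piHLB f_fast.
Qed.

Lemma fast_cauchy_cvg : exists F : HLrep R a b, forall k, `|piHL F - piHL (f k)| <= 2 * h ^+ k.
Proof.
have mf n : measurable_fun setT (f n) := HLfun_measurable (HLvalP (f n)).
have FB k : (fast_cauchy_lim - HLval (f k)) \in @HLfun R a b.
  have mF : measurable_fun setT (fast_cauchy_lim - HLval (f k)).
    by apply: measurable_funB; [exact: measurable_fast_cauchy_lim|exact: mf].
  apply/HLfunP; split => //; apply/integrableP; split; first exact: measurable_HLweightM.
  under eq_integral.
    move=> x /set_mem Ix; rewrite gee0_abs; last first.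
      by rewrite lee_fin -mulrA -expr2 mulr_ge0 ?sqr_ge0 ?HLweight_ge0.
    over.
  exact: le_lt_trans (fast_cauchy_lim_le k) (ltry _).
have F_HL : fast_cauchy_lim \in @HLfun R a b.
  by rewrite -[fast_cauchy_lim](subrK (HLval (f 0%N))) rpredD //; exact: HLvalP.
exists (MkHLrep F_HL) => k.
rewrite -(@ler_pXn2r _ 2) ?nnegrE ?mulr_ge0 ?exprn_ge0 ?invr_ge0 //.
by rewrite -piHLB -lee_fin -integral_HLnorm; exact: fast_cauchy_lim_le.
Qed.

End FastCauchy.

Lemma HL_complete (u : nat -> HL R a b) :
  (forall eps, 0 < eps -> exists N, forall n, (N <= n)%N -> `|u n - u N| < eps) -> cvgn u.
Proof.
move=> cu.
have h0 k : 0 < h ^+ k by rewrite exprn_gt0 // invr_gt0.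
have [N uN] := choice (fun k => cu _ (h0 k)).
(* The running maximum makes the extracted indices nondecreasing while staying above [N k]. *)
pose phi k := (\max_(i < k.+1) N i)%N.
have phiS k : (phi k <= phi k.+1)%N by rewrite /phi [leqRHS]big_ord_recr /= leq_maxl.
have phi_mono : {homo phi : k m / (k <= m)%N}.
  by apply: homo_leq => // ? ? ?; exact: leq_trans.
have Nphi k : (N k <= phi k)%N by rewrite /phi big_ord_recr /= leq_maxr.
(* Both [u n] and [u (phi k)] lie within [h ^+ k] of [u (N k)], whence the factor 2. *)
have fast k n : (phi k <= n)%N -> `|u n - u (phi k)| <= 2 * h ^+ k.
  move=> kn; rewrite -(subrKA (u (N k))) mulr_natl mulr2n.
  apply: le_trans (ler_normD _ _) (lerD _ _); first by apply/ltW/uN/(leq_trans (Nphi k)).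
  by rewrite distrC; exact/ltW/uN.
have [|F uF] := @fast_cauchy_cvg (fun k => repr (u (phi k))).
  by move=> k m km; rewrite !reprK; apply/fast/phi_mono.
apply/cvg_ex; exists (piHL F); apply/cvgrPdist_le => eps eps0.
(* The two distances through [u (phi k)] cost [2 * h ^+ k] each, hence eps/4. *)
have [k _ hk] : \forall k \near \oo, `|0 - h ^+ k| < eps / 4.
  have /cvgrPdist_lt : h ^+ k @[k --> \oo] --> 0.
    by apply: cvg_expr; rewrite ger0_norm ?invr_ge0 // invf_lt1 // ltr1n.
  by apply; rewrite divr_gt0.
have {hk} := hk k (leqnn _); rewrite sub0r normrN ger0_norm ?(ltW (h0 k)) // => hk.
exists (phi k) => // n /= kn; rewrite -(subrKA (u (phi k))).
have := uF k; rewrite reprK => uFk.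
apply: le_trans (ler_normD _ _) _; have := fast k n kn; rewrite distrC => fkn.
by move: uFk fkn hk; lra.
Qed.

End Completeness.

(** * Totality of the monomials *)

Section PolynomialStep.
Context (R : realType).
Implicit Types (x y t : R) (m n : nat).

Lemma bernoulli_onem y m : 0 <= y <= 1 -> 1 - m%:R * y <= (1 - y) ^+ m.
Proof.
move=> /andP[y0 y1]; elim: m => [|m IHm]; first by rewrite mul0r subr0 expr0.
rewrite exprS; apply: (@le_trans _ _ ((1 - y) * (1 - m%:R * y))).
  rewrite -natr1; have : 0 <= m%:R * y ^+ 2 by rewrite mulr_ge0 ?sqr_ge0.
  by move: (m%:R : R) => k; nra.
by rewrite ler_wpM2l // subr_ge0.
Qed.

Lemma bernoulli y m : 0 <= y -> 1 + m%:R * y <= (1 + y) ^+ m.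
Proof.
move=> y0; elim: m => [|m IHm]; first by rewrite mul0r addr0 expr0.
rewrite exprS; apply: (@le_trans _ _ ((1 + y) * (1 + m%:R * y))).
  rewrite -natr1; have : 0 <= m%:R * y ^+ 2 by rewrite mulr_ge0 ?sqr_ge0.
  by move: (m%:R : R) => k; nra.
by rewrite ler_wpM2l // addr_ge0.
Qed.

(** Bernoulli bounds m y by (1 + y)^m, and (1 - y)^m (1 + y)^m = (1 - y^2)^m is at most 1. *)
Lemma onem_exp_le y m : 0 <= y <= 1 -> (1 - y) ^+ m * (m%:R * y) <= 1.
Proof.
move=> /andP[y0 y1].
apply: (@le_trans _ _ ((1 - y) ^+ m * (1 + y) ^+ m)).
  rewrite ler_wpM2l ?exprn_ge0 ?subr_ge0 //.
  by apply: le_trans (bernoulli m y0); rewrite lerDr.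
rewrite -exprMn exprn_ile1 //; first by rewrite mulr_ge0 ?subr_ge0 ?addr_ge0.
by rewrite -subr_ge0 (_ : _ - _ = y ^+ 2) ?sqr_ge0 //; ring.
Qed.

Definition step_exponent t n : nat := (Num.truncn (t ^- n)).+1.

(* Converges boundedly on [0, 1] to the indicator of [0, t), away from [t],
   since [step_exponent t n * x ^+ n] behaves like [(x / t) ^+ n]. *)
Definition poly_step t n : {poly R} := (1 - 'X^n) ^+ step_exponent t n.

Lemma horner_poly_step t n x : (poly_step t n).[x] = (1 - x ^+ n) ^+ step_exponent t n.
Proof. by rewrite horner_exp !hornerE. Qed.

Lemma expr_01 n x : 0 <= x <= 1 -> 0 <= x ^+ n <= 1.
Proof. by move=> /andP[x0 x1]; rewrite exprn_ge0 // exprn_ile1. Qed.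

Lemma poly_step_01 t n x : 0 <= x <= 1 -> 0 <= (poly_step t n).[x] <= 1.
Proof.
move=> /(expr_01 n) /andP[y0 y1]; rewrite horner_poly_step expr_01 //.
by rewrite subr_ge0 y1 gerBl.
Qed.

(** The exponent m lies between t^(-n) and t^(-n) + 1. Below t, Bernoulli gives at least 1 - m x^n,
    which tends to 1; above t, [onem_exp_le] gives at most 1/(m x^n), hence at most (t/x)^n. *)
Lemma poly_step_cvg t x : 0 < t <= 1 -> 0 <= x <= 1 -> x != t ->
  (poly_step t n).[x] @[n --> \oo] --> (if x < t then 1 else 0 : R).
Proof.
move=> /andP[t0 t1] x01; case/andP: (x01) => x0 x1.
have tn n : 0 < t ^+ n by rewrite exprn_gt0.
have m_gt n : t ^- n < (step_exponent t n)%:R by rewrite truncnS_gt.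
have m_le n : (step_exponent t n)%:R <= t ^- n + 1.
  by rewrite -natr1 lerD2r truncn_le // invr_ge0 ltW.
rewrite neq_lt => /orP[xt|tx].
- rewrite xt /=; apply: (squeeze_cvgr (f := fun n => 1 - ((x / t) ^+ n + x ^+ n)) (h := fun=> 1)).
  + apply: nearW => n; have /andP[_ ->] := poly_step_01 t n x01; rewrite andbT.
    rewrite horner_poly_step; apply: le_trans (bernoulli_onem _ (expr_01 n x01)).
    rewrite lerD2l lerN2 (le_trans (ler_wpM2r (exprn_ge0 n x0) (m_le n))) //.
    by rewrite mulrDl mul1r exprMn exprVn mulrC.
  + rewrite -[X in _ --> X]subr0 -[X in _ --> _ - X](addr0 0).
    apply: cvgB; first exact: cvg_cst.
    apply: cvgD; apply: cvg_expr; rewrite ger0_norm ?divr_ge0 // ?ltW //.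
      by rewrite ltr_pdivrMr // mul1r.
    exact: lt_le_trans xt t1.
  + exact: cvg_cst.
- rewrite ltNge (ltW tx) /=; have xp : 0 < x by exact: lt_trans tx.
  apply: (squeeze_cvgr (f := fun=> 0) (h := fun n => (t / x) ^+ n)).
  + apply: nearW => n; have /andP[-> _] := poly_step_01 t n x01; rewrite /=.
    have := onem_exp_le (step_exponent t n) (expr_01 n x01); rewrite -horner_poly_step.
    have /andP[p0 _] := poly_step_01 t n x01; move: p0; move: (_.[x]) => p p0 pm.
    have xn : 0 < x ^+ n by rewrite exprn_gt0.
    rewrite exprMn exprVn ler_pdivlMr // -[leRHS]mul1r -ler_pdivrMr //.
    by apply: le_trans pm; rewrite -mulrA ler_wpM2l // mulrC ler_wpM2r // ltW.
  + exact: cvg_cst.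
  + by apply: cvg_expr; rewrite ger0_norm ?divr_ge0 ?ltW // ltr_pdivrMr // mul1r.
Qed.

End PolynomialStep.

Section Totality.
Context (R : realType) (a b : nat).
Local Notation mu := (@lebesgue_measure R).
Local Notation I01 := (`[0, 1]%classic : set R).
Local Notation w := (@HLweight R a b).
Local Notation piHL f := (\pi_(HL R a b)%qT f).

Lemma integral_poly_eq0 (f : HLrep R a b) (p : {poly R}) :
  (forall d, HLdot (HL_monomial R a b d) (piHL f) = 0) ->
  (\int[mu]_(x in I01) (w x * p.[x] * f x)%:E = 0)%E.
Proof.
move=> f0; pose g : HLrep R a b :=
  \sum_(i < size p) p`_i *: MkHLrep (@HL_monomial_subproof R a b i).
have gp x : g x = p.[x] by rewrite /g HLval_sum horner_coef.
have : HLdot (piHL g) (piHL f) = 0.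
  rewrite /g HL_pi_sum; elim/big_ind : _ => [|u v u0 v0|i _].
  - by rewrite -[0](scale0r 0) HLdotZl mul0r.
  - by rewrite HLdotDl u0 v0 addr0.
  - by rewrite HLdotZl f0 mulr0.
rewrite HLdot_pi => gf0; transitivity (\int[mu]_(x in I01) (w x * g x * f x)%:E)%E.
  by apply: eq_integral => x _; rewrite gp.
rewrite -[LHS]fineK ?[fine _]gf0 //.
by apply: integrable_fin_num => //; apply: HLfun_integrableM; exact: HLvalP.
Qed.

(** Dominated convergence along [poly_step t n], with dominating function |w f|; the exceptional
    point [t] is a null set. *)
Lemma integral_step_eq0 (f : HLrep R a b) t : 0 < t <= 1 ->
  (forall d, HLdot (HL_monomial R a b d) (piHL f) = 0) ->
  (\int[mu]_(x in I01) (w x * (if (x < t)%R then 1 else 0) * f x)%:E = 0)%E.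
Proof.
move=> t01 f0.
have mf := HLfun_measurable (HLvalP f).
have ae_t : {ae mu, forall x, x != t}.
  exists [set t]; split; [exact: measurable_set1|exact: lebesgue_measure_set1|].
  by move=> x /= /negP /negPn /eqP.
have iwf : mu.-integrable I01 (fun x => `|(w x * f x)%:E|%E).
  exact: (integrable_abse (HLfun_integrable (HLvalP f))).
have mp (p : R -> R) : measurable_fun setT p ->
    measurable_fun I01 (fun x => (w x * p x * f x)%:E).
  by move=> mp; exact: measurable_HLweightM.
have [] := @dominated_convergence _ _ R mu I01 (measurable_itv _)
  (fun n x => (w x * (poly_step t n).[x] * f x)%:E)
  (fun x => (w x * (if (x < t)%R then 1 else 0) * f x)%:E)
  (fun x => `|(w x * f x)%:E|%E) _ _ _ iwf _.
- by move=> n; apply: mp; apply: continuous_measurable_fun; exact: continuous_horner.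
- by apply: mp; apply: measurable_fun_ifT => //; exact: measurable_fun_ltr.
- apply: (@filterS _ _ (ae_filter_ringOfSetsType mu) _ _ _ ae_t) => x xt.
  rewrite /= in_itv /= => x01; apply: cvg_EFin; first exact: nearW.
  apply: cvgMr_tmp; apply: cvgMl_tmp; exact: poly_step_cvg.
- apply: aeW => x n; rewrite /= in_itv /= => x01; rewrite lee_fin.
  rewrite mulrAC normrM ler_piMr //; have /andP[p0 p1] := poly_step_01 t n x01.
  by rewrite ger0_norm.
move=> _ _; rewrite (_ : [sequence _]_n = cst 0%E).
  by move/cvg_lim => <- //; rewrite lim_cst.
by apply/funext => n; exact: integral_poly_eq0.
Qed.

(** Orthogonality to all steps makes the primitive [F] of w f vanish on the open interval; Lebesgue
    differentiation gives w f = 0 almost everywhere, and [w] is positive there. *)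
Lemma HL_total (u : HL R a b) : (forall d, HLdot (HL_monomial R a b d) u = 0) -> u = 0.
Proof.
rewrite -[u]reprK; move: (repr u) => f f0.
pose g := (fun x => w x * f x) \_ I01.
have ig : mu.-integrable setT (EFin \o g).
  rewrite -restrict_EFin; have := HLfun_integrable (HLvalP f).
  by move=> /(integrable_mkcond _ _).1; apply; exact: measurable_itv.
have lg : locally_integrable setT g.
  by apply: open_integrable_locally => //; exact: openT.
pose F x := \int[mu]_(t in `]-oo, x]) g t.
have F0 t : 0 < t < 1 -> F t = 0.
  (* The ray is opened at [t] to match the strict inequality that defines the step. *)
  move=> /andP[t0 t1]; rewrite /F -Rintegral_itv_bndo_bndc; last first.
    by apply: integrableS ig.
  rewrite /Rintegral -[RHS]/(fine 0); congr fine.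
  rewrite -(@integral_step_eq0 f t) // ?t0 ?ltW //.
  rewrite integral_mkcond [RHS]integral_mkcond; apply: eq_integral => x _.
  rewrite !patchE /g mem_setE in_itv /= patchE.
  case: (ltP x t) => xt; case: ifPn => // Ix.
  - by rewrite mulr1.
  - by rewrite mulr0 mul0r.
have igy y : mu.-integrable `]-oo, y] (EFin \o g) by apply: integrableS ig.
have := FTC1Ny igy lg.
move=> /= dF.
have -> : (0 : HL R a b) = piHL 0 by apply: (addrI (piHL 0)); rewrite -HL_piD !addr0.
apply/HL_eqP; apply: (@filterS2 _ _ (ae_filter_ringOfSetsType mu) _ _ _ _ (@ae_01 R) dF).
move=> x x01 [_ Fx] Ix.
have Fx0 : F^`()%classic x = 0.
  rewrite derive1E (near_eq_derive (g := cst 0)) ?derive_cst //.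
  have /(_ (x01 Ix)) : 0 < x < 1 -> \forall y \near x, 0 < y < 1.
    by move=> h; apply: (@near_in_itvoo _ 0 1 x); rewrite in_itv.
  by apply: filterS => y /F0.
move: Fx; rewrite -/F Fx0 /g patchE mem_set // => /esym/eqP.
by rewrite mulf_eq0 gt_eqF ?HLweight_gt0 ?x01 //= => /eqP.
Qed.

End Totality.

(** * The spectral decomposition *)

Section Lambda.
Context (R : realType) (a b : nat).
Local Notation lam := (lambda R a b).

Lemma lambda_gt0 d : 0 < lam d.
Proof. by rewrite divr_gt0 // ltr0n bin_gt0 ?leq_addl // -addnA addnC -addnA leq_addr. Qed.

(** The ratio is below 1, which drives both the strict decrease and the decay rate. *)
Lemma lambdaS d : lam d.+1 = lam d * ((a + d).+1%:R / (a + b + d).+2%:R).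
Proof.
have binS n m : 'C(n.+1, m.+1)%:R = n.+1%:R * 'C(n, m)%:R / m.+1%:R :> R.
  by rewrite -natrM mul_bin_diag natrM mulrAC divff ?mul1r // pnatr_eq0.
rewrite /lambda addnS !addn1 addnS !binS.
have := @lambda_gt0 d; rewrite /lambda addn1.
have : 'C((a + b + d).+1, d)%:R != 0 :> R by rewrite pnatr_eq0 -lt0n bin_gt0 ltnW // ltnS leq_addl.
have : d.+1%:R != 0 :> R by rewrite pnatr_eq0.
have : (a + b + d).+2%:R != 0 :> R by rewrite pnatr_eq0.
move: ((a + b + d).+2%:R) (d.+1%:R) ('C((a + b + d).+1, d)%:R) => x y z x0 y0 z0 _.
by field; rewrite x0 y0 z0.
Qed.

Lemma lambdaS_lt d : lam d.+1 < lam d.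
Proof.
rewrite lambdaS gtr_pMr ?lambda_gt0 // ltr_pdivrMr ?ltr0n // mul1r ltr_nat.
by rewrite !ltnS -addnA [(b + d)%N]addnC addnA leq_addr.
Qed.

Lemma lambda_inj : injective lam.
Proof.
have lam_lt : {homo lam : i j / (i < j)%N >-> j < i}.
  apply: (@homo_ltn _ lam (fun x y => y < x)); last exact: lambdaS_lt.
  by move=> x y z yx zx; exact: lt_trans zx yx.
move=> i j eij; case: (ltngtP i j) => // /lam_lt; by rewrite eij ltxx.
Qed.

Lemma lambda_le d : lam d <= a.+1%:R / d.+1%:R.
Proof.
(* This sharper bound is the one that the recurrence preserves; it is an equality when b = 0. *)
suff lamM : lam d * (a + d).+1%:R <= a.+1%:R.
  rewrite ler_pdivlMr ?ltr0n //; apply: le_trans lamM.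
  by rewrite ler_wpM2l ?(ltW (lambda_gt0 d)) // ler_nat ltnS leq_addl.
elim: d => [|d IHd]; first by rewrite /lambda !bin0 divr1 mul1r addn0.
apply: le_trans IHd; rewrite lambdaS -[leLHS]mulrA ler_wpM2l ?(ltW (lambda_gt0 d)) //.
rewrite -mulrA ler_piMr // mulrC ler_pdivrMr ?ltr0n // mul1r ler_nat addnS !ltnS.
by rewrite -addnA [(b + d)%N]addnC addnA leq_addr.
Qed.

Definition LPeigenvalue d : R := (-1) ^+ d * lam d.

Lemma normr_LPeigenvalue d : `|LPeigenvalue d| = lam d.
Proof. by rewrite normrM normrX normrN1 expr1n mul1r gtr0_norm ?lambda_gt0. Qed.

Lemma LPeigenvalue_inj : injective LPeigenvalue.
Proof. by move=> i j /(congr1 Num.norm); rewrite !normr_LPeigenvalue => /lambda_inj. Qed.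

End Lambda.

Theorem theorem9p6 (R : realType) (a b : nat) :
  exists LP : {linear HL R a b -> HL R a b},
  [/\ is_LP LP,
      compact_operator LP /\ self_adjoint (@HLdot R a b) LP,
      [set l | op_eigenvalue LP l] =
        [set (-1) ^+ d * lambda R a b d | d in [set: nat]],
      forall d, `|HLg R a b d| = 1 /\
        (forall u, LP u = ((-1) ^+ d * lambda R a b d) *: u <->
           exists c : R, u = c *: HLg R a b d) &
      orthonormal_basis (@HLdot R a b) (HLg R a b) /\
      forall f : HL R a b,
        (\sum_(0 <= d < n)
           ((-1) ^+ d * lambda R a b d * HLdot (HLg R a b d) f) *: HLg R a b d)
          @[n --> \oo] --> LP f].
Proof.
pose T : {linear HL R a b -> HL R a b} := @LP_HL R a b.
have dotC := @HLdotC R a b.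
have dotPl := @HLdotPl R a b.
have dotN := @HLdot_norm R a b.
have free n : ~ spanned (@HL_monomial R a b) n (HL_monomial R a b n).
  by move=> [c]; exact: HL_monomial_free.
have triangular n : spanned (@HL_monomial R a b) n
    (T (HL_monomial R a b n) - LPeigenvalue R a b n *: HL_monomial R a b n).
  (* The top term of the expansion, whose binomial coefficient is 1, is the diagonal one and
     cancels. *)
  rewrite /T /= LP_HL_monomial big_ord_recr /= binn mulr1n addrK.
  by exists (fun k => (-1) ^+ k *+ 'C(n, k) * lambda R a b k).
have sym i j := @LP_HL_symmetric R a b (HL_monomial R a b i) (HL_monomial R a b j).
have Tg := gram_schmidt_eigen dotC dotPl dotN free sym triangular.
have g_on := gram_schmidt_orthonormal dotC dotPl dotN free.
have g_total u : (forall i, HLdot (HLg R a b i) u = 0) -> u = 0.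
  by move=> /(gram_schmidt_total dotC dotPl dotN free); exact: HL_total.
have T_le := @LP_HL_norm R a b.
have complete := @HL_complete R a b.
have T_bound n : `|LPeigenvalue R a b n| <= a.+1%:R / n.+1%:R.
  by rewrite normr_LPeigenvalue lambda_le.
exists T; split.
- exact: LP_HL_is_LP.
- split; last exact: LP_HL_symmetric.
  exact: (diagonal_compact dotC dotPl dotN g_on g_total complete T_le Tg T_bound).
- exact: (diagonal_eigenvalue dotC dotPl dotN g_on g_total complete T_le Tg).
- move=> d; split; first exact: (orthonormal_norm1 dotN g_on).
  move=> u; apply: (diagonal_eigenspace dotC dotPl dotN g_on g_total complete T_le Tg).
  exact: LPeigenvalue_inj.
- split; last by move=> f; exact: (diagonal_cvg dotC dotPl dotN g_on g_total complete T_le Tg).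
  split => //; exact: (orthosum_closure dotC dotPl dotN g_on g_total complete).
Qed.
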